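(* Let $\varphi\colon\mathbb{R}^n\to\overline{\mathbb{R}}$ be fully subamenable at $\bar x\in\operatorname{dom}\varphi$, with local representation $\varphi=\vartheta\circ f$, and let $\Omega:=\{x\in\mathbb{R}^n\mid f(x)\in\operatorname{dom}\vartheta\}$, $\bar z:=(\bar x,\varphi(\bar x))$, and $q_w:=(w,\mathrm{d}\varphi(\bar x)(w))$. Then $\partial\varphi(\bar x)=\partial_p\varphi(\bar x)$ and $T^2_{\operatorname{epi}\varphi}(\bar z,q_w)\ne\emptyset$ for any $w\in T_\Omega(\bar x)$. Consequently, $$K_\varphi(\bar x,\bar v)=\operatorname{dom}\mathrm{d}^2\varphi(\bar x,\bar v)\quad\text{whenever }\bar v\in\partial\varphi(\bar x).$$
   Context: $\overline{\mathbb{R}}:=(-\infty,\infty]$, $\operatorname{dom}\varphi:=\{x\mid\varphi(x)<\infty\}$, $\operatorname{epi}\varphi:=\{(x,\alpha)\mid\alpha\ge\varphi(x)\}$. A mapping $f$ is twice differentiable at $\bar x$ if it is differentiable in a neighborhood of $\bar x$ and $\nabla f$ is differentiable at $\bar x$. $\vartheta\colon\mathbb{R}^m\to\overline{\mathbb{R}}$ is piecewise linear-quadratic (PWLQ) if $\operatorname{dom}\vartheta=\bigcup_{i=1}^s\Omega_i$ with polyhedral convex sets $\Omega_i$ and $\vartheta(y)=\frac12\langle A_iy,y\rangle+\langle a_i,y\rangle+\alpha_i$ for $y\in\Omega_i$, with symmetric matrices $A_i$, $a_i\in\mathbb{R}^m$, $\alpha_i\in\mathbb{R}$. $\varphi$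 is fully subamenable at $\bar x\in\operatorname{dom}\varphi$ if on a neighborhood of $\bar x$ it is represented as $\varphi=\vartheta\circ f$ where $f\colon\mathbb{R}^n\to\mathbb{R}^m$ is twice differentiable at $\bar x$, $\vartheta\colon\mathbb{R}^m\to\overline{\mathbb{R}}$ is convex PWLQ, and the metric subregularity qualification condition (MSQC) holds: there are $\kappa\ge0$ and a neighborhood $U$ of $\bar x$ with $\operatorname{dist}(x;\Omega)\le\kappa\operatorname{dist}(f(x);\operatorname{dom}\vartheta)$ for all $x\in U$, where $\Omega:=\{x\mid f(x)\in\operatorname{dom}\vartheta\}$. Tangent cone: $T_\Omega(\bar x):=\{w\mid\exists\,t_k\downarrow0,\ w_k\to w,\ \bar x+t_kw_k\in\Omega\}$. Second-order tangent set: $T^2_\Omega(\bar x,w):=\{u\mid\exists\,t_k\downarrow0,\ u_k\to u,\ \bar x+t_kw+\frac12t_k^2u_k\in\Omega\}$. Regular normal cone: $\widehat N_\Omega(\bar x):=\{v\mid\limsup_{x\to\bar x,\,x\in\Omega}\frac{\langle v,x-\bar x\rangle}{\|x-\bar x\|}\le 0\}$; limiting normal cone $N_\Omega(\bar x)$: all limits of $v_k\in\widehat N_\Omega(x_k)$ with $x_k\to\bar x$, $x_k\in\Omega$. Limiting subdifferential: $\partial\varphi(\bar x):=\{v\mid(v,-1)\in N_{\operatorname{epi}\varphi}(\bar x,\varphi(\bar x))\}$. Proximal subdifferential $\partial_p\varphi(\bar x)$: all $v$ for which there are $\gamma,r>0$ with $\varphi(x)\ge\varphi(\bar x)+\langle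 v,x-\bar x\rangle-\frac r2\|x-\bar x\|^2$ whenever $\|x-\bar x\|\le\gamma$. Subderivative: $\mathrm{d}\varphi(\bar x)(\bar w):=\liminf_{t\downarrow 0,\,w\to\bar w}\frac{\varphi(\bar x+tw)-\varphi(\bar x)}{t}$. Second subderivative: $\mathrm{d}^2\varphi(\bar x,\bar v)(w):=\liminf_{t\downarrow0,\,u\to w}\frac{\varphi(\bar x+tu)-\varphi(\bar x)-t\langle\bar v,u\rangle}{\frac12t^2}$. Critical cone: $K_\varphi(\bar x,\bar v):=\{w\mid\mathrm{d}\varphi(\bar x)(w)=\langle\bar v,w\rangle\}$. *)

(* Defs.v *)
From HB Require Import structures.
From mathcomp Require Export all_boot all_order all_algebra.
From mathcomp Require Export all_classical all_reals all_analysis.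

Set Implicit Arguments.
Unset Strict Implicit.
Unset Printing Implicit Defensive.

Export Order.TTheory GRing.Theory Num.Theory.
Export numFieldNormedType.Exports.

Local Open Scope classical_set_scope.
Local Open Scope ring_scope.

(* R^n is 'rV[R]_n.  The library norm on 'rV[R]_n is the sup norm, which
   induces the usual topology; wherever the mathematics measures lengths, the
   Euclidean norm [enorm] below is used instead. *)
Definition dotv (R : realType) n (u v : 'rV[R]_n) : R :=
  \sum_(i < n) u 0 i * v 0 i.

Definition enorm (R : realType) n (u : 'rV[R]_n) : R := Num.sqrt (dotv u u).

(* dist(x; set0) = +oo. *)
Definition edist_set (R : realType) n (x : 'rV[R]_n) (S : set 'rV[R]_n) :
    \bar R :=
  ereal_inf [set (enorm (x - y))%:E | y in S].

(* R^n * R is identified with 'rV[R]_(n + 1), with the scalar as the last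
   coordinate. *)
Definition vpair (R : realType) n (x : 'rV[R]_n) (a : R) : 'rV[R]_(n + 1) :=
  row_mx x (a%:M).

(* Functions into (-oo, +oo] are functions into \bar R avoiding -oo. *)
Definition no_ninfty (R : realType) (T : Type) (phi : T -> \bar R) : Prop :=
  forall x, phi x != -oo%E.

Definition edom (R : realType) (T : Type) (phi : T -> \bar R) : set T :=
  [set x | (phi x < +oo)%E].

Definition epi (R : realType) n (phi : 'rV[R]_n -> \bar R) :
    set 'rV[R]_(n + 1) :=
  [set z | exists x a, z = vpair x a /\ (phi x <= a%:E)%E].

Definition twice_differentiable_at (R : realType) n m
    (f : 'rV[R]_n -> 'rV[R]_m) (x : 'rV[R]_n) : Prop :=
  (\forall y \near x, differentiable f y) /\
  differentiable (fun y => jacobian f y) x.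

Definition polyhedral (R : realType) m (S : set 'rV[R]_m) : Prop :=
  exists (p : nat) (b : 'I_p -> 'rV[R]_m) (c : 'I_p -> R),
    S = [set y | forall j, dotv (b j) y <= c j].

Definition convex_efun (R : realType) m (theta : 'rV[R]_m -> \bar R) : Prop :=
  forall (y z : 'rV[R]_m) (t : R), 0 < t < 1 ->
    (theta (t *: y + (1 - t) *: z)%R
       <= t%:E * theta y + (1 - t)%:E * theta z)%E.

Definition pwlq (R : realType) m (theta : 'rV[R]_m -> \bar R) : Prop :=
  exists (s : nat) (S : 'I_s -> set 'rV[R]_m) (A : 'I_s -> 'M[R]_m)
         (a : 'I_s -> 'rV[R]_m) (alpha : 'I_s -> R),
    [/\ forall i, polyhedral (S i),
        forall i, (A i)^T = A i,
        edom theta = \bigcup_i S i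
      & forall i y, S i y ->
          theta y = (2^-1 * dotv (y *m A i) y + dotv (a i) y + alpha i)%:E].

(* Metric subregularity qualification condition for f(x) \in D. *)
Definition msqc (R : realType) n m (f : 'rV[R]_n -> 'rV[R]_m)
    (D : set 'rV[R]_m) (xbar : 'rV[R]_n) : Prop :=
  exists kappa : R, 0 <= kappa /\
    \forall x \near xbar,
      (edist_set x (f @^-1` D) <= kappa%:E * edist_set (f x) D)%E.

(* phi is fully subamenable at xbar \in dom phi, with local representation
   phi = theta \o f. *)
Definition fully_subamenable_with (R : realType) n m
    (phi : 'rV[R]_n -> \bar R) (xbar : 'rV[R]_n)
    (theta : 'rV[R]_m -> \bar R) (f : 'rV[R]_n -> 'rV[R]_m) : Prop :=
  [/\ no_ninfty phi, no_ninfty theta & edom phi xbar] /\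
  [/\ \forall x \near xbar, phi x = theta (f x),
      twice_differentiable_at f xbar,
      convex_efun theta,
      pwlq theta
    & msqc f (edom theta) xbar].

Definition tangent_cone (R : realType) n (S : set 'rV[R]_n)
    (xbar : 'rV[R]_n) : set 'rV[R]_n :=
  [set w | exists (t : nat -> R) (wk : nat -> 'rV[R]_n),
    [/\ forall k, 0 < t k, t k @[k --> \oo] --> 0,
        wk k @[k --> \oo] --> w
      & forall k, S (xbar + t k *: wk k)]].

Definition second_tangent_set (R : realType) n (S : set 'rV[R]_n)
    (xbar w : 'rV[R]_n) : set 'rV[R]_n :=
  [set u | exists (t : nat -> R) (uk : nat -> 'rV[R]_n),
    [/\ forall k, 0 < t k, t k @[k --> \oo] --> 0,
        uk k @[k --> \oo] --> u
      & forall k, S (xbar + t k *: w + (2^-1 * t k ^+ 2) *: uk k)]].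

(* The limsup is over the punctured neighborhoods of xbar within S; it is -oo
   when xbar is isolated in S. *)
Definition regular_normal_cone (R : realType) n (S : set 'rV[R]_n)
    (xbar : 'rV[R]_n) : set 'rV[R]_n :=
  [set v | (limf_esup
              (fun x : 'rV[R]_n => (dotv v (x - xbar) / enorm (x - xbar))%:E)
              (within S xbar^') <= 0)%E].

Definition normal_cone (R : realType) n (S : set 'rV[R]_n)
    (xbar : 'rV[R]_n) : set 'rV[R]_n :=
  [set v | exists (xk vk : nat -> 'rV[R]_n),
    [/\ forall k, S (xk k), xk k @[k --> \oo] --> xbar,
        forall k, regular_normal_cone S (xk k) (vk k)
      & vk k @[k --> \oo] --> v]].

(* From here on phi is meant to be finite at xbar. *)
Definition subdifferential (R : realType) n (phi : 'rV[R]_n -> \bar R)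
    (xbar : 'rV[R]_n) : set 'rV[R]_n :=
  [set v | normal_cone (epi phi) (vpair xbar (fine (phi xbar)))
             (vpair v (-1))].

Definition prox_subdifferential (R : realType) n (phi : 'rV[R]_n -> \bar R)
    (xbar : 'rV[R]_n) : set 'rV[R]_n :=
  [set v | exists gamma r : R, [/\ 0 < gamma, 0 < r
    & forall x, enorm (x - xbar) <= gamma ->
        (phi xbar + (dotv v (x - xbar) - r / 2 * enorm (x - xbar) ^+ 2)%:E
           <= phi x)%E]].

Definition subderivative (R : realType) n (phi : 'rV[R]_n -> \bar R)
    (xbar wbar : 'rV[R]_n) : \bar R :=
  limf_einf
    (fun p : R * 'rV[R]_n =>
       (phi (xbar + p.1 *: p.2)%R - phi xbar) * (p.1^-1)%:E)%E
    (filter_prod 0^'+ (nbhs wbar)).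

Definition second_subderivative (R : realType) n (phi : 'rV[R]_n -> \bar R)
    (xbar vbar w : 'rV[R]_n) : \bar R :=
  limf_einf
    (fun p : R * 'rV[R]_n =>
       (phi (xbar + p.1 *: p.2)%R - phi xbar - (p.1 * dotv vbar p.2)%:E)
         * ((2^-1 * p.1 ^+ 2)^-1)%:E)%E
    (filter_prod 0^'+ (nbhs w)).

Definition critical_cone (R : realType) n (phi : 'rV[R]_n -> \bar R)
    (xbar vbar : 'rV[R]_n) : set 'rV[R]_n :=
  [set w | subderivative phi xbar w = (dotv vbar w)%:E].

(* Main.v *)
From mathcomp Require Import ring lra.
Require Import Defs.

(** Write [J] for the Jacobian of [f] at [xbar] and [D] for the domain of
    [theta].  The argument rests on a consequence of the representation
    [phi = theta o f] and of the qualification condition, a correction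
    property ([local_modelP]): if [x] is near [xbar] and [y] in [D] is near
    [f xbar], the qualification condition moves [x] by [O(|f x - y|)] to a
    point [x'] with [f x'] in [D], and since [theta] is Lipschitz on [D] near
    [f xbar] ([pwlq_lipschitz]) this gives
    [phi x' <= theta y + O(|f x - y|)].  The slack left in the infimum that
    defines the distance is absorbed by an arbitrarily small [eta].

    Limiting subgradients are proximal.  Let [(u, -b)] be a regular normal to
    the epigraph at [(x1, a1)].  Test it along the corrections of [x1 + t h]
    towards the point [f x1 + t (y - f x1)], which lies in [D] by convexity.
    Dividing by [t] yields an upper bound of [<u, h>] by
    [b (theta y - theta (f x1))] plus a multiple of
    [|h J - (y - f xbar)|], with a constant that does not depend on [x1] and
    up to errors that vanish as [x1] approaches [xbar]
    ([regular_normal_estimate]).  Such an inequality passes to the limit, so a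
    limiting subgradient [v] satisfies
    [theta y - theta (f xbar) >= <v, h> - M |h J - (y - f xbar)|] for all [h]
    and all [y] in [D] ([limiting_subgradient_estimate]); taking
    [h = x - xbar] and [y = f x], the last term is [O(|x - xbar|^2)] because
    the Jacobian is calm at [xbar].

    Second-order tangents.  Let [w] be tangent to the feasible set.  A finite
    union of polyhedra contains a short segment in every direction that is
    tangent to it ([polyhedral_union_ray]), so [theta] is a quadratic
    polynomial in [t] along [f xbar + t (w J)], whose slope turns out to be the
    subderivative of [phi].  Correcting [xbar + t w] towards this ray costs
    only [O(t^2)], as [f (xbar + t w)] is within [O(t^2)] of the ray
    ([recovery]).  Hence the rescaled second-order displacements stay bounded, and a cluster point
    of them is a second-order tangent ([recovery_second_tangent]).

    Critical directions.  A second-order tangent in the direction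
    [(w, <v, w>)] bounds the second-order quotients along a sequence, so [w]
    is in the domain of the second subderivative.  Conversely bounded
    second-order quotients force the subderivative at [w] to be at most
    [<v, w>], and the proximal inequality gives the opposite bound.

    Estimates are carried out in the sup norm of matrices; the Euclidean norm
    only enters through its equivalence with it. *)

Set Implicit Arguments.
Unset Strict Implicit.
Unset Printing Implicit Defensive.

Local Open Scope classical_set_scope.
Local Open Scope ring_scope.

(** * Norms, pairings and lower limits *)

Section Norms.
Context {R : realType}.

Lemma normr_coord_le m n (M : 'M[R]_(m, n)) i j : `|M i j| <= `|M|.
Proof.
rewrite [leRHS]/Num.Def.normr/= mx_normrE.
exact: (le_bigmax _ (fun k : 'I_m * 'I_n => `|M k.1 k.2|) (i, j)).
Qed.

Lemma normr_mx_le m n (M : 'M[R]_(m, n)) e :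
  0 <= e -> (forall i j, `|M i j| <= e) -> `|M| <= e.
Proof.
move=> e0 Me; rewrite [leLHS]/Num.Def.normr/= mx_normrE.
by apply: bigmax_le => // k _; exact: Me.
Qed.

Lemma sum_ord_le n (F : 'I_n -> R) c :
  (forall i, F i <= c) -> \sum_(i < n) F i <= n%:R * c.
Proof.
move=> Fc; apply: le_trans (ler_sum _ (fun i _ => Fc i)) _.
by rewrite sumr_const card_ord mulr_natl.
Qed.

Lemma normr_mulmx_le m n p (A : 'M[R]_(m, n)) (B : 'M[R]_(n, p)) :
  `|A *m B| <= n%:R * `|A| * `|B|.
Proof.
apply: normr_mx_le => [|i j]; first by rewrite !mulr_ge0.
rewrite mxE (le_trans (ler_norm_sum _ _ _))//.
rewrite -mulrA; apply: sum_ord_le => k.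
by rewrite normrM ler_pM// normr_coord_le.
Qed.

Lemma dotvE n (u v : 'rV[R]_n) : dotv u v = (u *m v^T) 0 0.
Proof. by rewrite mxE; apply: eq_bigr => i _; rewrite mxE. Qed.

Lemma dotvDr n (u v w : 'rV[R]_n) : dotv u (v + w) = dotv u v + dotv u w.
Proof. by rewrite !dotvE linearD/= mulmxDr mxE. Qed.

Lemma dotvDl n (u v w : 'rV[R]_n) : dotv (u + v) w = dotv u w + dotv v w.
Proof. by rewrite !dotvE mulmxDl mxE. Qed.

Lemma dotvZr n (u v : 'rV[R]_n) t : dotv u (t *: v) = t * dotv u v.
Proof. by rewrite !dotvE linearZ/= -scalemxAr mxE. Qed.

Lemma dotvZl n (u v : 'rV[R]_n) t : dotv (t *: u) v = t * dotv u v.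
Proof. by rewrite !dotvE -scalemxAl mxE. Qed.

Lemma dotvBr n (u v w : 'rV[R]_n) : dotv u (v - w) = dotv u v - dotv u w.
Proof. by rewrite dotvDr -scaleN1r dotvZr mulN1r. Qed.

Lemma dotvBl n (u v w : 'rV[R]_n) : dotv (u - v) w = dotv u w - dotv v w.
Proof. by rewrite dotvDl -scaleN1r dotvZl mulN1r. Qed.

Lemma normr_dotv_le n (u v : 'rV[R]_n) : `|dotv u v| <= n%:R * `|u| * `|v|.
Proof.
rewrite /dotv (le_trans (ler_norm_sum _ _ _))//.
rewrite -mulrA; apply: sum_ord_le => k.
by rewrite normrM ler_pM// normr_coord_le.
Qed.

Lemma enorm_ge0 n (u : 'rV[R]_n) : 0 <= enorm u.
Proof. exact: sqrtr_ge0. Qed.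

Lemma normr_le_enorm n (u : 'rV[R]_n) : `|u| <= enorm u.
Proof.
apply: normr_mx_le => [|i j]; first exact: enorm_ge0.
rewrite ord1 -sqrtr_sqr ler_wsqrtr// /dotv (bigD1 j)//= -expr2 lerDl.
by apply: sumr_ge0 => k _; rewrite -expr2 sqr_ge0.
Qed.

Lemma enorm_le_normr n (u : 'rV[R]_n) : enorm u <= n%:R * `|u|.
Proof.
have h : 0 <= n%:R * `|u| by rewrite mulr_ge0.
rewrite -(ger0_norm h) -sqrtr_sqr ler_wsqrtr//.
rewrite (le_trans (ler_norm _))// (le_trans (normr_dotv_le _ _))//.
rewrite exprMn expr2 -mulrA -expr2 ler_wpM2r ?sqr_ge0// -natrM ler_nat.
by case: n {u h} => // n; rewrite leq_pmulr.
Qed.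

Lemma enorm_gt0 n (u : 'rV[R]_n) : u != 0 -> 0 < enorm u.
Proof. by move=> u0; rewrite (lt_le_trans _ (normr_le_enorm u))// normr_gt0. Qed.

Lemma vpairB n (x y : 'rV[R]_n) a b : vpair x a - vpair y b = vpair (x - y) (a - b).
Proof. by rewrite /vpair opp_row_mx add_row_mx raddfB. Qed.

Lemma vpairD n (x y : 'rV[R]_n) a b : vpair x a + vpair y b = vpair (x + y) (a + b).
Proof. by rewrite /vpair add_row_mx raddfD. Qed.

Lemma vpairZ n (x : 'rV[R]_n) a t : t *: vpair x a = vpair (t *: x) (t * a).
Proof. by rewrite /vpair scale_row_mx scale_scalar_mx. Qed.

Lemma dotv_vpair n (x y : 'rV[R]_n) a b :
  dotv (vpair x a) (vpair y b) = dotv x y + a * b.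
Proof.
rewrite /dotv /vpair big_split_ord/= big_ord1; congr (_ + _).
  by apply: eq_bigr => i _; rewrite !row_mxEl.
by rewrite !row_mxEr !mxE eqxx !mulr1n.
Qed.

Lemma vpairP n (z : 'rV[R]_(n + 1)) : exists x a, z = vpair x a.
Proof.
exists (lsubmx z), (rsubmx z 0 0); rewrite /vpair -[LHS]hsubmxK; congr row_mx.
by rewrite [LHS]mx11_scalar.
Qed.

Lemma vpair_inj n (x y : 'rV[R]_n) a b : vpair x a = vpair y b -> x = y /\ a = b.
Proof.
rewrite /vpair => xy; have [-> e] := eq_row_mx xy; split=> //.
by have := congr1 (fun M : 'M[R]_1 => M 0 0) e; rewrite !mxE eqxx !mulr1n.
Qed.

Lemma normr_vpair_le n (x : 'rV[R]_n) a : `|vpair x a| <= `|x| + `|a|.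
Proof.
apply: normr_mx_le => [|i j]; first by rewrite addr_ge0.
rewrite /vpair mxE; case: fintype.split => k.
  by rewrite (le_trans (normr_coord_le _ _ _))// lerDl.
by rewrite !ord1 mxE eqxx mulr1n lerDr.
Qed.

Lemma normr_le_vpair n (x : 'rV[R]_n) a : `|x| <= `|vpair x a| /\ `|a| <= `|vpair x a|.
Proof.
split.
  apply: normr_mx_le => // i j; rewrite -(row_mxEl x (a%:M)).
  exact: normr_coord_le.
have := normr_coord_le (vpair x a) 0 (rshift n 0).
by rewrite /vpair row_mxEr mxE eqxx mulr1n.
Qed.

End Norms.

Section EfunLimits.
Context {R : realType} {T : choiceType} {X : filteredType T}.
Implicit Types (g : X -> \bar R) (F : set_system X).

Lemma limf_einf_le g F (a : \bar R) :
  (forall V, F V -> exists2 p, V p & (g p <= a)%E) -> (limf_einf g F <= a)%E.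
Proof.
move=> h; rewrite limf_einfE; apply: ge_ereal_sup => _ [V FV <-].
by have [p Vp gp] := h _ FV; apply: le_trans gp; apply: ereal_inf_lbound; exists p.
Qed.

Lemma le_limf_einf g F (a : \bar R) :
  F [set p | (a <= g p)%E] -> (a <= limf_einf g F)%E.
Proof.
move=> h; rewrite limf_einfE.
apply: le_trans (ereal_sup_ubound _); last by exists [set p | (a <= g p)%E].
by apply: le_ereal_inf_tmp => _ [p ap <-].
Qed.

Lemma limf_einf_lt g F (a : \bar R) : (limf_einf g F < a)%E ->
  forall V, F V -> exists2 p, V p & (g p < a)%E.
Proof.
rewrite limf_einfE => h V FV; apply: contrapT => H.
move: h; rewrite ltNge => /negP; apply.
apply: le_trans (ereal_sup_ubound _); last by exists V.
apply: le_ereal_inf_tmp => _ [p Vp <-]; rewrite leNgt; apply/negP => gp.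
by apply: H; exists p.
Qed.

Lemma limf_esup_le0P g F : Filter F ->
  (limf_esup g F <= 0)%E <-> forall e : R, 0 < e -> F [set p | (g p <= e%:E)%E].
Proof.
move=> FF; split=> [h e e0|h].
  have : (limf_esup g F < e%:E)%E by rewrite (le_lt_trans h)// lte_fin.
  rewrite limf_esupE => /ereal_inf_lt[_ [V FV <-] lte].
  apply: filterS FV => p Vp /=; apply: le_trans (ltW lte).
  by apply: ereal_sup_ubound; exists p.
apply/lee_addgt0Pr => e e0; rewrite add0e limf_esupE.
apply: le_trans (ereal_inf_lbound _) _; first by exists [set p | (g p <= e%:E)%E]; [exact: h|].
by apply: ge_ereal_sup => _ [p gp <-].
Qed.

End EfunLimits.

Section Balls.
Context {R : realType} {V : pseudoMetricNormedZmodType R}.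

(** Closed balls, rather than open ones, let the radii obtained below be used
    at their end points. *)
Lemma near_ballP (x : V) (P : V -> Prop) :
  (\forall y \near x, P y) <->
  exists2 r : R, 0 < r & forall y, `|y - x| <= r -> P y.
Proof.
split=> [/nbhs_normP[r /= r0 h]|[r r0 h]].
  exists (r / 2) => [|y yx]; first by rewrite divr_gt0.
  by apply: h => /=; rewrite distrC (le_lt_trans yx)// ltr_pdivrMr// ltr_pMr// ltr1n.
by apply/nbhs_normP; exists r => //= y /= /ltW yx; apply: h; rewrite distrC.
Qed.

End Balls.

Lemma near_rightP {R : realType} (P : R -> Prop) :
  (\forall t \near 0^'+, P t) <->
  exists2 r : R, 0 < r & forall t, 0 < t -> t <= r -> P t.
Proof.
rewrite near_withinE; split=> [h|[r r0 h]].
  have [r r0 {}h] := (near_ballP 0 (fun t : R => 0 < t -> P t)).1 h.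
  exists r => // t t0 tr; apply: h => //.
  by rewrite subr0 ger0_norm// ltW.
apply: (near_ballP 0 (fun t : R => 0 < t -> P t)).2; exists r => // t.
rewrite subr0 => tr t0; apply: h => //.
by rewrite (le_trans (ler_norm t)).
Qed.

Lemma near_right_prodP {R : realType} {V : normedModType R} (w : V) (P : R * V -> Prop) :
  filter_prod 0^'+ (nbhs w) P <->
  exists2 r : R, 0 < r &
    forall t u, 0 < t -> t <= r -> `|u - w| <= r -> P (t, u).
Proof.
split=> [[[A B] /= [/near_rightP[r r0 hA] /near_ballP[s s0 hB]] AB]|[r r0 h]].
  exists (Num.min r s) => [|t u t0]; first by rewrite lt_min r0.
  rewrite !le_min => /andP[tr _] /andP[_ us].
  by apply: AB; split; [exact: hA|exact: hB].
exists ([set t | 0 < t <= r], [set u | `|u - w| <= r]) => /=.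
  split; last by apply/near_ballP; exists r.
  by apply/near_rightP; exists r => // t t0 tr; rewrite /= t0.
by move=> [t u] [/= /andP[t0 tr] uw]; exact: h.
Qed.

Section SequencesAndRays.
Context {R : realType}.

Lemma near_right_mul_le (A B : R) : 0 < B -> \forall t \near 0^'+, t * A <= B.
Proof.
move=> B0; apply/near_rightP; have A0 : 0 < `|A| + 1 by rewrite ltr_wpDl.
exists (B / (`|A| + 1)); first by rewrite divr_gt0.
move=> t t0; rewrite ler_pdivlMr//; apply: le_trans.
by rewrite ler_pM2l// (le_trans (ler_norm _))// lerDl.
Qed.

Lemma cvg_near_ball n (zk : nat -> 'rV[R]_n) (z : 'rV[R]_n) (e : R) :
  zk k @[k --> \oo] --> z -> 0 < e -> \forall k \near \oo, `|zk k - z| <= e.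
Proof.
move=> /cvgrPdist_le h e0; have := h _ e0.
by apply: filterS => k; rewrite distrC.
Qed.

Lemma near_natSinv_le (e : R) : 0 < e -> \forall k \near \oo, k.+1%:R^-1 <= e.
Proof.
move=> e0; have := near_infty_natSinv_lt (PosNum e0).
by apply: filterS => k /ltW.
Qed.

Lemma cvg_of_le_natSinv n (zk : nat -> 'rV[R]_n) (z : 'rV[R]_n) :
  (forall k, `|zk k - z| <= k.+1%:R^-1) -> zk k @[k --> \oo] --> z.
Proof.
move=> h; apply/cvgrPdist_le => e e0.
near=> k; rewrite distrC (le_trans (h k))//.
by near: k; exact: near_natSinv_le.
Unshelve. all: by end_near. Qed.

End SequencesAndRays.

(** * Strict differentiability *)

Section StrictDifferentiability.
Context {R : realType}.

(** Applied to the Jacobian of a twice differentiable mapping, this linear rate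
    is the source of all the quadratic error terms below. *)
Lemma differentiable_calm {V W : normedModType R} (g : V -> W) (x : V) :
  differentiable g x ->
  exists2 C : R, 0 < C & \forall y \near x, `|g y - g x| <= C * `|y - x|.
Proof.
move=> dg; have [k k0 hk] := linear_lipschitz (diff_continuous dg).
exists (k + 1); first by rewrite addr_gt0.
have /eqaddoP/(_ 1 ltr01)/near_ballP[r r0 ho] := diff_locally dg.
apply/near_ballP; exists r => // y yx.
have := ho (y - x); rewrite subr0 /= => /(_ yx).
rewrite /shift !fctE /= subrK mul1r => {}ho.
have -> : g y - g x = g y - (g x + 'd g x (y - x)) + 'd g x (y - x).
  by rewrite opprD addrA subrK.
by rewrite (le_trans (ler_normD _ _))// mulrDl mul1r addrC lerD.
Qed.

Lemma is_derive_line {V W : normedModType R} (g : V -> W) (a d : V) (s : R) :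
  differentiable g (a + s *: d) ->
  is_derive s 1 (fun t : R => g (a + t *: d)) ('d g (a + s *: d) d).
Proof.
move=> dg; have dv : derivable g (a + s *: d) d by exact: diff_derivable.
rewrite -deriveE//.
have E : (fun h : R => h^-1 *: (g (a + (h *: (1 : R) + s) *: d) - g (a + s *: d))) =
         (fun h : R => h^-1 *: (g (h *: d + (a + s *: d)) - g (a + s *: d))).
  apply/funext => h; congr (_ *: (g _ - _)).
  by rewrite [h *: 1]mulr1 scalerDl addrCA addrA.
by apply: DeriveDef; rewrite /derivable /derive /= E.
Qed.

Lemma coordB m n (A B : 'M[R]_(m, n)) i j : (A - B) i j = A i j - B i j.
Proof. by rewrite !mxE. Qed.

(** Gives the derivative of the linear part subtracted in the mean value
    argument of [strict_estimate]. *)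
Lemma is_derive_mulr_cst (c s : R) : is_derive s 1 (fun t : R => t * c) c.
Proof.
have := is_deriveZ (c : R^o) (is_derive_id s 1).
rewrite [_ *: _]mulr1; congr is_derive; apply/funext => t.
by rewrite mulrC.
Qed.

(** The mean value theorem bounds the increment of [f - J] between two points
    of the ball of radius [rho] by the variation of the Jacobian there, which
    is [O(rho)] since the Jacobian is calm at [xbar].  With [rho] fixed this
    is strict differentiability; with [x' = xbar] and [rho = |x - xbar|] it is
    a quadratic Taylor estimate. *)
Lemma strict_estimate n m (f : 'rV[R]_n -> 'rV[R]_m) (xbar : 'rV[R]_n) :
  twice_differentiable_at f xbar ->
  exists2 C : R, 0 < C & exists2 r : R, 0 < r &
    forall rho (x x' : 'rV[R]_n), rho <= r -> `|x - xbar| <= rho -> `|x' - xbar| <= rho ->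
      `|f x - f x' - (x - x') *m jacobian f xbar| <= C * rho * `|x - x'|.
Proof.
case=> /near_ballP[r1 r10 df] /differentiable_calm[C C0 /near_ballP[r2 r20 hC]].
exists (n%:R * C + 1); first by rewrite ltr_wpDl// mulr_ge0// ltW.
exists (Num.min r1 r2); first by rewrite lt_min r10.
move=> rho x x'; rewrite le_min => /andP[rr1 rr2] xr x'r.
have rho0 : 0 <= rho by exact: le_trans xr.
set d := x - x'; set J := jacobian f xbar.
(* The segment stays in the ball by convexity. *)
have inball (s : R) : 0 <= s <= 1 -> `|x' + s *: d - xbar| <= rho.
  move=> /andP[s0 s1].
  have -> : x' + s *: d - xbar = s *: (x - xbar) + (1 - s) *: (x' - xbar).
    apply/rowP => i; rewrite !mxE; ring.
  rewrite (le_trans (ler_normD _ _))// !normrZ !ger0_norm ?subr_ge0//.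
  have -> : rho = s * rho + (1 - s) * rho by ring.
  by rewrite lerD// ler_wpM2l// subr_ge0.
apply: normr_mx_le => [|i j].
  by rewrite !mulr_ge0// addr_ge0// mulr_ge0// ltW.
rewrite ord1 {i}.
pose h (s : R) := (f (x' + s *: d)) 0 j - s * (d *m J) 0 j.
pose dh (s : R) := (d *m (jacobian f (x' + s *: d) - J)) 0 j.
have hd (s : R) : 0 <= s <= 1 -> is_derive s 1 h (dh s).
  move=> /inball s01.
  have dfs : differentiable f (x' + s *: d) by apply: df; exact: le_trans rr1.
  have [dl El] := is_derive_line dfs.
  have dc := (derivable_mxP _ _ _).1 dl 0 j.
  have Ec : 'D_1 (fun t : R => f (x' + t *: d) 0 j) s = (d *m jacobian f (x' + s *: d)) 0 j.
    by move: El; rewrite -deriveE// deriveEjacobian// => <-; rewrite derive_mx// mxE.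
  have -> : dh s = 'D_1 (fun t : R => f (x' + t *: d) 0 j) s - (d *m J) 0 j.
    by rewrite Ec /dh mulmxBr coordB.
  exact: is_deriveB (derivableP dc) (is_derive_mulr_cst _ _).
have [c c01 hE] : exists2 c, c \in `[0, 1]%R & h 1 - h 0 = dh c * (1 - 0).
  apply: MVT_segment => //.
  - by move=> s; rewrite in_itv/= => /andP[s0 s1]; apply: hd; rewrite !ltW.
  - apply: derivable_within_continuous => s; rewrite in_itv/= => s01.
    by have [] := hd s s01.
move: hE; rewrite /h scale1r scale0r addr0 mul1r mul0r subr0 subr0 mulr1.
have -> : x' + d = x by rewrite /d addrC subrK.
move=> hE.
have -> : (f x - f x' - d *m J) 0 j = dh c.
  by rewrite -hE !coordB; ring.
rewrite (le_trans (normr_coord_le _ _ _))// (le_trans (normr_mulmx_le _ _))//.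
move: c01; rewrite in_itv/= => /inball c01.
have := hC _ (le_trans c01 rr2); rewrite -/J => hJ.
have {}hJ : `|jacobian f (x' + c *: d) - J| <= C * rho.
  by rewrite (le_trans hJ)// ler_wpM2l// ltW.
rewrite (le_trans (ler_wpM2l _ hJ)) ?mulr_ge0//.
rewrite mulrDl mul1r mulrDl.
have : 0 <= rho * `|d| by rewrite mulr_ge0.
have -> : n%:R * `|d| * (C * rho) = n%:R * C * rho * `|d| by ring.
by rewrite lerDl.
Qed.

End StrictDifferentiability.

(** * Piecewise linear-quadratic functions *)

Section Polyhedral.
Context {R : realType} {m : nat}.
Implicit Types (S : set 'rV[R]_m) (y z w : 'rV[R]_m).

(** Strict inequalities are stable under short moves in nearby directions. *)
Lemma open_halfspace_near_ray (b y w : 'rV[R]_m) (c : R) :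
  dotv b y < c -> filter_prod 0^'+ (nbhs w)
    [set p : R * 'rV[R]_m | dotv b (y + p.1 *: p.2) < c].
Proof.
move=> bc; apply/near_right_prodP.
pose N := m%:R * `|b| * (`|w| + 1) + 1.
have N0 : 0 < N by rewrite ltr_wpDl// !mulr_ge0// addr_ge0.
exists (Num.min 1 ((c - dotv b y) / N)).
  by rewrite lt_min ltr01 divr_gt0// subr_gt0.
move=> t u t0; rewrite !le_min => /andP[_ tN] /andP[uw _] /=.
rewrite dotvDr dotvZr -ltrBrDl (@lt_le_trans _ _ (t * N))//; last by rewrite -ler_pdivlMr.
rewrite ltr_pM2l// (le_lt_trans (ler_norm _))// (le_lt_trans (normr_dotv_le _ _))//.
rewrite /N ltr_pwDr// ler_wpM2l ?mulr_ge0//.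
by rewrite -[u](subrK w) addrC (le_trans (ler_normD _ _))// lerD2l.
Qed.

(** Conic structure of a polyhedron at [y].  If a constraint is violated at
    [y], or is active and strictly increasing along [w], then all nearby
    directions leave [S].  Otherwise the active constraints hold along the
    whole ray and the inactive ones hold for a short time. *)
Lemma polyhedral_ray S y w : polyhedral S ->
  (exists2 e : R, 0 < e & forall t, 0 <= t <= e -> S (y + t *: w)) \/
  filter_prod 0^'+ (nbhs w) [set p : R * 'rV[R]_m | ~ S (y + p.1 *: p.2)].
Proof.
case=> p [b [c ->]].
have dotvN (u v : 'rV[R]_m) : dotv (- u) v = - dotv u v.
  by rewrite -scaleN1r dotvZl mulN1r.
have [[j cj]|H1] := pselect (exists j, c j < dotv (b j) y).
  right; have := @open_halfspace_near_ray (- b j) y w (- c j).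
  rewrite dotvN ltrN2 => /(_ cj); apply: filterS => -[t u] /=.
  by rewrite dotvN ltrN2 => h /(_ j); rewrite leNgt h.
have {}H1 j : dotv (b j) y <= c j.
  by rewrite leNgt; apply/negP => cj; apply: H1; exists j.
have [[j [cj bw]]|H2] := pselect (exists j, dotv (b j) y = c j /\ 0 < dotv (b j) w).
  right; apply/near_right_prodP.
  exists (dotv (b j) w / (m%:R * `|b j| + 1)).
    by rewrite divr_gt0// ltr_wpDl// mulr_ge0.
  move=> t u t0 _ uw /= /(_ j); apply/negP; rewrite -ltNge.
  rewrite dotvDr dotvZr cj ltrDl mulr_gt0//.
  rewrite -[u](subrK w) dotvDr -ltrBlDr sub0r.
  have := normr_dotv_le (b j) (u - w); rewrite ler_norml => /andP[+ _].
  apply: lt_le_trans; rewrite ltrN2.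
  have [->|un0] := eqVneq (u - w) 0; first by rewrite normr0 mulr0.
  move: uw; rewrite ler_pdivlMr ?ltr_wpDl ?mulr_ge0// mulrDr mulr1 mulrC.
  by apply: lt_le_trans; rewrite ltrDl normr_gt0.
left.
have /near_rightP[e e0 he] : \forall t \near 0^'+, forall j, dotv (b j) (y + t *: w) <= c j.
  apply: filter_forall => j; apply/near_rightP.
  have [cj|cj] := eqVneq (dotv (b j) y) (c j).
    exists 1 => // t t0 _; rewrite dotvDr dotvZr cj gerDl.
    rewrite pmulr_rle0// leNgt; apply/negP => bw; apply: H2.
    by exists j.
  have /(@open_halfspace_near_ray _ _ w)/near_right_prodP[e e0 h] : dotv (b j) y < c j.
    by rewrite lt_neqAle cj H1.
  exists e => // t t0 te; apply/ltW/(h t w) => //.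
  by rewrite subrr normr0 ltW.
exists e => // t /andP[]; rewrite le_eqVlt => /predU1P[<- _ /= j|t0 te].
  by rewrite scale0r addr0.
exact: he.
Qed.

(** The two cases say that the ray of direction [w] starts inside one piece,
    or that [w] is not tangent to the union; finiteness of the number of
    pieces is what makes them exhaustive. *)
Lemma polyhedral_union_ray s (S : 'I_s -> set 'rV[R]_m) y w :
  (forall i, polyhedral (S i)) ->
  (exists i, exists2 e : R, 0 < e & forall t, 0 <= t <= e -> S i (y + t *: w)) \/
  filter_prod 0^'+ (nbhs w)
    [set p : R * 'rV[R]_m | ~ (\bigcup_i S i) (y + p.1 *: p.2)].
Proof.
move=> hS.
have [[i hi]|H] := pselect (exists i, exists2 e : R, 0 < e &
    forall t, 0 <= t <= e -> S i (y + t *: w)).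
  by left; exists i.
right.
have : filter_prod 0^'+ (nbhs w)
    [set p : R * 'rV[R]_m | forall i, ~ S i (y + p.1 *: p.2)].
  have FF : Filter (filter_prod (0 : R)^'+ (nbhs w)) by exact: filter_prod_filter.
  apply: (@filter_forall _ _ (fun i (p : R * 'rV[R]_m) =>
    ~ S i (y + p.1 *: p.2)) _ FF) => i.
  by have [h|//] := polyhedral_ray y w (hS i); case: H; exists i.
by apply: filterS => p /= h [i _] /h.
Qed.

End Polyhedral.

Section PWLQ.
Context {R : realType} {m : nat}.
Variables (theta : 'rV[R]_m -> \bar R).

Definition quadratic (A : 'M[R]_m) (a : 'rV[R]_m) (alpha : R) (y : 'rV[R]_m) : R :=
  2^-1 * dotv (y *m A) y + dotv a y + alpha.

Lemma quadratic_lipschitz A a alpha (B : R) : 0 <= B ->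
  exists2 L : R, 0 <= L & forall y z, `|y| <= B -> `|z| <= B ->
    `|quadratic A a alpha y - quadratic A a alpha z| <= L * `|y - z|.
Proof.
move=> B0; exists (m%:R * (m%:R * B * `|A|) + m%:R * `|a|).
  by rewrite addr_ge0// !mulr_ge0.
move=> y z yB zB.
have -> : quadratic A a alpha y - quadratic A a alpha z =
    2^-1 * (dotv (y *m A) (y - z) + dotv ((y - z) *m A) z) + dotv a (y - z).
  rewrite /quadratic mulmxBl dotvBl !dotvBr; lra.
have yA (u : 'rV[R]_m) : `|u *m A| <= m%:R * `|A| * `|u|.
  by rewrite (le_trans (normr_mulmx_le _ _))// mulrAC.
rewrite (le_trans (ler_normD _ _))// mulrDl lerD ?normr_dotv_le//.
rewrite normrM ger0_norm ?invr_ge0// ler_pdivrMl//.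
rewrite (le_trans (ler_normD _ _))// mulrC mulr_natr mulr2n.
apply: lerD; rewrite (le_trans (normr_dotv_le _ _))//.
  rewrite ler_wpM2r// ler_wpM2l// (le_trans (yA y))//.
  by rewrite [leRHS]mulrAC ler_wpM2l// mulr_ge0.
rewrite -!mulrA ler_wpM2l// (@le_trans _ _ (m%:R * `|A| * `|y - z| * B))//.
  by rewrite ler_pM.
by rewrite le_eqVlt; apply/orP; left; apply/eqP; ring.
Qed.

Hypothesis (Htheta : pwlq theta).

Lemma pwlq_fineK y : edom theta y -> theta y = (fine (theta y))%:E.
Proof.
case: Htheta => s [S [A [a [al [_ _ -> hS]]]]] [i _ Siy].
by rewrite (hS _ _ Siy).
Qed.

Hypothesis (Hconv : convex_efun theta).

Lemma convex_fine y z t : edom theta y -> edom theta z -> 0 < t < 1 ->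
  edom theta (t *: y + (1 - t) *: z) /\
  fine (theta (t *: y + (1 - t) *: z)) <=
    t * fine (theta y) + (1 - t) * fine (theta z).
Proof.
move=> Dy Dz t01; have := Hconv y z t01.
rewrite (pwlq_fineK Dy) (pwlq_fineK Dz) -!EFinM -EFinD => h.
have Dp : edom theta (t *: y + (1 - t) *: z).
  by rewrite /edom/= (le_lt_trans h)// ltry.
by split=> //; move: h; rewrite (pwlq_fineK Dp) lee_fin.
Qed.

Lemma pwlq_ray y w :
  (exists c q : R, exists2 e : R, 0 < e & forall t, 0 <= t <= e ->
     theta (y + t *: w) = (fine (theta y) + t * c + t ^+ 2 * q)%:E) \/
  filter_prod 0^'+ (nbhs w)
    [set p : R * 'rV[R]_m | ~ edom theta (y + p.1 *: p.2)].
Proof.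
case: Htheta => s [S [A [a [al [pS _ -> hS]]]]].
have [[i [e e0 he]]|] := polyhedral_union_ray y w pS; last by right.
left; exists (2^-1 * (dotv (y *m A i) w + dotv (w *m A i) y) + dotv (a i) w).
exists (2^-1 * dotv (w *m A i) w); exists e => // t te.
have Sy : S i y by move: (he 0); rewrite scale0r addr0; apply; rewrite lexx ltW.
rewrite (hS _ _ (he _ te)) (hS _ _ Sy)/=; congr EFin.
rewrite mulmxDl -scalemxAl !dotvDl !dotvDr !dotvZl !dotvZr; ring.
Qed.

(** Let [L] be a common Lipschitz constant of the pieces on the ball.  Near
    its end point [y], the segment from [y] to [z] lies in one piece, so the
    slope of [theta] there is at most [L]; by convexity this slope dominates
    the slope of the chord. *)
Lemma pwlq_lipschitz (ybar : 'rV[R]_m) : exists2 L : R, 0 < L &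
  forall y z, edom theta y -> edom theta z -> `|y - ybar| <= 1 -> `|z - ybar| <= 1 ->
    `|fine (theta y) - fine (theta z)| <= L * `|y - z|.
Proof.
have [s [S [A [a [al [pS _ DE hS]]]]]] := Htheta.
have B0 : 0 <= `|ybar| + 1 by rewrite addr_ge0.
pose Lip i := cid2 (quadratic_lipschitz (A i) (a i) (al i) B0).
pose L i := s2val (Lip i).
have L0 i : 0 <= L i by rewrite /L; case: (Lip i).
exists (1 + \sum_i L i); first by rewrite ltr_pwDl// sumr_ge0.
suff H y z : edom theta y -> edom theta z -> `|y - ybar| <= 1 -> `|z - ybar| <= 1 ->
    fine (theta y) - fine (theta z) <= (1 + \sum_i L i) * `|y - z|.
  move=> y z Dy Dz yb zb; rewrite ler_norml H// andbT.
  by rewrite lerNl opprB distrC H.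
move=> Dy Dz yb zb.
have inB (u : 'rV[R]_m) : `|u - ybar| <= 1 -> `|u| <= `|ybar| + 1.
  by move=> ub; rewrite -[u](subrK ybar) addrC (le_trans (ler_normD _ _))// lerD2l.
have E (t : R) : y + t *: (z - y) = t *: z + (1 - t) *: y.
  by apply/rowP => k; rewrite !mxE; ring.
(* Directions leaving the domain are excluded since the segment is in it. *)
have [[i [e e0 he]]|] := polyhedral_union_ray y (z - y) pS; last first.
  rewrite -DE => /near_right_prodP[e e0 he]; exfalso.
  have m0 : 0 < Num.min e 2^-1 by rewrite lt_min e0/= invr_gt0.
  apply: (he (Num.min e 2^-1) (z - y)) => //=.
  - by rewrite ge_min lexx.
  - by rewrite subrr normr0 ltW.
  rewrite E; apply: (convex_fine Dz Dy _).1.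
  by rewrite m0/= gt_min invf_lt1// ltr1n orbT.
pose t := Num.min e 2^-1.
have t0 : 0 < t by rewrite lt_min e0/= invr_gt0.
have te : t <= e by rewrite ge_min lexx.
have t1 : t < 1 by rewrite gt_min invf_lt1// ltr1n orbT.
have Sy : S i y by move: (he 0); rewrite scale0r addr0; apply; rewrite lexx ltW.
have Sp : S i (y + t *: (z - y)) by apply: he; rewrite te ltW.
have [Dp cp] : _ /\ _ := convex_fine Dz Dy (introT andP (conj t0 t1)).
rewrite -(ler_pM2l t0).
rewrite (@le_trans _ _ (fine (theta y) - fine (theta (y + t *: (z - y)))))//.
  rewrite E mulrBr; move: cp; rewrite mulrBl mul1r => cp.
  lra.
rewrite (hS _ _ Sy) (hS _ _ Sp) /= (le_trans (ler_norm _))//.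
have HL := s2valP' (Lip i).
rewrite (le_trans (HL _ _ _ _)) ?inB//.
  have -> : y + t *: (z - y) - ybar = t *: (z - ybar) + (1 - t) *: (y - ybar).
    by apply/rowP => k; rewrite !mxE; ring.
  rewrite (le_trans (ler_normD _ _))// !normrZ !ger0_norm ?subr_ge0 ?(ltW t0) ?(ltW t1)//.
  have {2}-> : 1 = t * 1 + (1 - t) * 1 :> R by ring.
  by rewrite lerD// ler_wpM2l// ?subr_ge0 ltW.
rewrite opprD addNKr normrN normrZ gtr0_norm// mulrCA ler_wpM2l ?(ltW t0)//.
rewrite distrC ler_wpM2r// -/(L i) (bigD1 i)//= addrCA lerDl addr_ge0//.
exact: sumr_ge0.
Qed.

End PWLQ.

(** * The local model: correcting a point to feasibility *)

Section LocalModel.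
Context {R : realType} {n m : nat}.
Variables (phi : 'rV[R]_n -> \bar R) (xbar : 'rV[R]_n).
Variables (theta : 'rV[R]_m -> \bar R) (f : 'rV[R]_n -> 'rV[R]_m).

(** The infimum in the distance need not be attained, whence the slack
    [eta]. *)
Lemma msqc_approx (D : set 'rV[R]_m) : msqc f D xbar ->
  exists2 k : R, 0 < k & \forall x \near xbar, forall y eta, D y -> 0 < eta ->
    exists2 x', D (f x') & `|x - x'| <= k * (`|f x - y| + eta).
Proof.
case=> k [k0 /near_ballP[r r0 h]]; exists (k * m%:R + 1).
  by rewrite ltr_wpDl// mulr_ge0.
apply/near_ballP; exists r => // x /h {}h y eta Dy eta0.
have : (edist_set x (f @^-1` D) < (k * enorm (f x - y) + eta)%:E)%E.
  apply: le_lt_trans h _; rewrite EFinD EFinM.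
  apply: (@le_lt_trans _ _ (k%:E * (enorm (f x - y))%:E)%E).
    by apply: lee_wpmul2l; rewrite ?lee_fin//; apply: ereal_inf_lbound; exists y.
  by rewrite -EFinM -EFinD lte_fin ltrDl.
move=> /ereal_inf_lt[_ [x' Dx' <-]]; rewrite lte_fin => lt_x'.
exists x' => //; rewrite (le_trans (normr_le_enorm _))// (le_trans (ltW lt_x'))//.
rewrite mulrDl mul1r lerD ?lerDr// (@le_trans _ _ (k * (m%:R * `|f x - y|)))//.
  by rewrite ler_wpM2l// enorm_le_normr.
by rewrite mulrA ler_wpM2l ?mulr_ge0// lerDl ltW.
Qed.

(** Everything that is used about [phi], [theta] and [f] near [xbar], with
    uniform constants.  The decisive clause is [lm_correction]. *)
Record local_model (C r K : R) : Prop := LocalModel {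
  lm_C_gt0 : 0 < C;
  lm_r_gt0 : 0 < r;
  lm_K_gt0 : 0 < K;
  lm_fine : forall y, edom theta y -> theta y = (fine (theta y))%:E;
  lm_convex : forall y z t, edom theta y -> edom theta z -> 0 < t < 1 ->
    edom theta (t *: y + (1 - t) *: z) /\
    fine (theta (t *: y + (1 - t) *: z)) <=
      t * fine (theta y) + (1 - t) * fine (theta z);
  lm_base : edom theta (f xbar);
  lm_rep : forall x, `|x - xbar| <= r -> phi x = theta (f x);
  lm_strict : forall rho (x x' : 'rV[R]_n), rho <= r ->
    `|x - xbar| <= rho -> `|x' - xbar| <= rho ->
    `|f x - f x' - (x - x') *m jacobian f xbar| <= C * rho * `|x - x'|;
  lm_f_lipschitz : forall x x' : 'rV[R]_n, `|x - xbar| <= r -> `|x' - xbar| <= r ->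
    `|f x - f x'| <= K * `|x - x'|;
  lm_theta_lipschitz : forall y z, edom theta y -> edom theta z ->
    `|y - f xbar| <= r -> `|z - f xbar| <= r ->
    `|fine (theta y) - fine (theta z)| <= K * `|y - z|;
  lm_correction : forall x y eta, `|x - xbar| <= r -> `|y - f xbar| <= r ->
    edom theta y -> 0 < eta -> eta <= r ->
    exists x', [/\ `|x - x'| <= K * (`|f x - y| + eta), edom theta (f x') &
      (phi x' <= (fine (theta y) + K * (`|f x - y| + eta))%:E)%E]
}.

Lemma local_modelP : fully_subamenable_with phi xbar theta f ->
  exists C r K, local_model C r K.
Proof.
case=> -[_ _ domx] [/near_ballP[r1 r10 rep] f2 cvx pw /msqc_approx].
case=> k k0 /near_ballP[r2 r20 hmsqc].
have [C C0 [r3 r30 strict]] := strict_estimate f2.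
have [l l0 thlip] := pwlq_lipschitz pw cvx (f xbar).
(* On the ball of radius [r4] all the local hypotheses hold, and [f] is
   [L]-Lipschitz; the radius [r] is so small that corrections of points of the
   ball of radius [r] stay in the ball of radius [r4] and that their images
   stay in the unit ball around [f xbar]. *)
pose r4 := Num.min 1 (Num.min r1 (Num.min r2 r3)).
have r40 : 0 < r4 by rewrite !lt_min ltr01 r10 r20 r30.
have [r41 r4r1 r4r2 r4r3] : [/\ r4 <= 1, r4 <= r1, r4 <= r2 & r4 <= r3].
  by rewrite /r4; split; rewrite !ge_min lexx ?orbT.
pose J := jacobian f xbar.
pose L := C * r4 + n%:R * `|J| + 1.
have L1 : 1 <= L by rewrite lerDr addr_ge0// mulr_ge0// ltW.
have L0 : 0 < L by exact: lt_le_trans L1.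
have lip (x x' : 'rV[R]_n) : `|x - xbar| <= r4 -> `|x' - xbar| <= r4 ->
    `|f x - f x'| <= L * `|x - x'|.
  move=> xr x'r; have := strict _ _ _ r4r3 xr x'r; rewrite -/J => h.
  rewrite -[f x - f x'](subrK ((x - x') *m J)) (le_trans (ler_normD _ _))//.
  have -> : L * `|x - x'| = C * r4 * `|x - x'| + (n%:R * `|x - x'| * `|J| + `|x - x'|).
    by rewrite /L; ring.
  by rewrite lerD// (le_trans (normr_mulmx_le _ _))// lerDl.
pose K := L + l + k + l * (L * k + 1).
have K'0 : 0 < l * (L * k + 1) by rewrite mulr_gt0// ltr_wpDl// mulr_ge0// ltW.
have [LK lK kK lLK] : [/\ L <= K, l <= K, k <= K & l * (L * k + 1) <= K].
  by rewrite /K; split; lra.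
have K0 : 0 < K by exact: lt_le_trans LK.
pose q := L * (1 + k * (L + 2)).
have q1 : 1 <= 1 + k * (L + 2) by rewrite lerDl mulr_ge0 ?ltW// addr_gt0.
have q0 : 0 < q by rewrite mulr_gt0// (lt_le_trans ltr01).
pose r := r4 / q.
have r0 : 0 < r by rewrite divr_gt0.
have rq : r * q = r4 by rewrite /r divfK// gt_eqF.
have rr4' : r * (1 + k * (L + 2)) <= r4.
  rewrite -rq ler_pM2l// /q ler_peMl//; exact: le_trans q1.
have rr4 : r <= r4.
  by apply: le_trans rr4'; rewrite ler_peMr// ltW.
have fbar : edom theta (f xbar).
  by move: domx; rewrite /edom/= rep// subrr normr0 ltW.
exists C, r, K; split => //.
- exact: pwlq_fineK.
- by move=> y z t; exact: convex_fine.
- by move=> x xr; apply: rep; rewrite (le_trans xr)// (le_trans rr4).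
- move=> rho x x' rhor xr x'r; apply: strict => //.
  by rewrite (le_trans rhor)// (le_trans rr4).
- move=> x x' xr x'r; rewrite (le_trans (lip _ _ _ _)) ?(le_trans _ rr4)//.
  by rewrite ler_wpM2r.
- move=> y z Dy Dz yr zr.
  rewrite (le_trans (thlip y z Dy Dz _ _)) ?(le_trans yr) ?(le_trans zr) ?(le_trans rr4)//.
  by rewrite ler_wpM2r.
move=> x y eta xr yr Dy eta0 etar.
have xr4 : `|x - xbar| <= r4 by exact: le_trans rr4.
have [x' Dx' xx'] := hmsqc x (le_trans xr4 r4r2) y eta Dy eta0.
set d := `|f x - y| + eta in xx' *.
have d0 : 0 <= d by rewrite addr_ge0// ltW.
have dr : d <= (L + 2) * r.
  have -> : (L + 2) * r = L * r + r + r by ring.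
  rewrite /d lerD//.
  rewrite -[f x - y](subrKA (f xbar)) (le_trans (ler_normD _ _))//.
  rewrite [`|f xbar - y|]distrC lerD// (le_trans (lip _ _ _ _))//.
    by rewrite subrr normr0 ltW.
  by rewrite ler_pM2l.
have x'r' : `|x' - xbar| <= r * (1 + k * (L + 2)).
  rewrite -[x' - xbar](subrKA x) (le_trans (ler_normD _ _))// addrC.
  rewrite mulrDr mulr1 lerD// distrC (le_trans xx')//.
  by rewrite mulrCA ler_pM2l// mulrC.
have x'r : `|x' - xbar| <= r4 by exact: le_trans rr4'.
exists x'; split => //.
  by rewrite (le_trans xx')// ler_wpM2r.
rewrite rep; last by rewrite (le_trans x'r).
rewrite (pwlq_fineK pw Dx') lee_fin -lerBlDl (le_trans (ler_norm _))//.
rewrite (le_trans (thlip _ _ Dx' Dy _ _))//.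
- rewrite (le_trans (lip _ _ _ _))//; first by rewrite subrr normr0 ltW.
  apply: le_trans r41; rewrite -rq.
  have -> : r * q = L * (r * (1 + k * (L + 2))) by rewrite /q; ring.
  by rewrite ler_pM2l.
- by rewrite (le_trans yr)// (le_trans rr4).
rewrite (@le_trans _ _ (l * (L * k + 1) * d))//; last by rewrite ler_wpM2r.
rewrite -mulrA ler_pM2l// mulrDl mul1r -[f x' - y](subrKA (f x)).
rewrite (le_trans (ler_normD _ _))// lerD//; last by rewrite lerDl ltW.
by rewrite (le_trans (lip _ _ _ _))// -mulrA ler_pM2l// distrC.
Qed.

End LocalModel.

(** * Normals and limiting subgradients *)

Section RegularNormals.
Context {R : realType}.

(** The change of norm only rescales the tolerance [e]. *)
Lemma regular_normalP n (S : set 'rV[R]_n) (x v : 'rV[R]_n) :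
  regular_normal_cone S x v <->
  forall e : R, 0 < e -> exists2 d : R, 0 < d & forall z, `|z - x| <= d -> S z ->
    dotv v (z - x) <= e * `|z - x|.
Proof.
rewrite /regular_normal_cone /=.
have PF := @limf_esup_le0P R _ 'rV[R]_n
  (fun z : 'rV[R]_n => (dotv v (z - x) / enorm (z - x))%:E) (within S x^') _.
have {}PF := PF (within_filter _ _).
split.
  move=> /PF h e e0; have n0 : 0 < n%:R + 1 :> R by rewrite ltr_wpDl.
  have /near_ballP[d d0 hd] := h (e / (n%:R + 1)) (divr_gt0 e0 n0).
  exists d => // z zd Sz.
  have [->|zx] := eqVneq z x; first by rewrite subrr dotvE linear0 mulmx0 mxE normr0 mulr0.
  have := hd z zd zx Sz; rewrite /= lee_fin ler_pdivrMr ?enorm_gt0 ?subr_eq0// => {}h.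
  rewrite (le_trans h)// mulrAC ler_pdivrMr// -mulrA ler_pM2l// mulrC.
  by rewrite (le_trans (enorm_le_normr _))// ler_wpM2r// lerDl.
move=> h; apply/PF => e e0; have [d d0 hd] := h e e0.
suff : \forall z \near x, z != x -> S z ->
    ((dotv v (z - x) / enorm (z - x))%:E <= e%:E)%E by [].
apply/near_ballP; exists d => // z zd zx Sz.
rewrite lee_fin ler_pdivrMr ?enorm_gt0 ?subr_eq0//.
rewrite (le_trans (hd _ zd Sz))// ler_wpM2l ?(ltW e0)//.
exact: normr_le_enorm.
Qed.

Lemma epi_vpair n (phi : 'rV[R]_n -> \bar R) x a :
  epi phi (vpair x a) <-> (phi x <= a%:E)%E.
Proof.
split=> [[x' [a' [/vpair_inj[<- <-]]]]//|h].
by exists x, a.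
Qed.

(** A proximal subgradient is a regular normal to the epigraph at the base
    point itself, so constant sequences are enough. *)
Lemma proximal_subgradient_limiting n (phi : 'rV[R]_n -> \bar R) xbar v :
  phi xbar = (fine (phi xbar))%:E ->
  prox_subdifferential phi xbar v -> subdifferential phi xbar v.
Proof.
move=> phiE [g [r [g0 r0 h]]].
exists (fun=> vpair xbar (fine (phi xbar))), (fun=> vpair v (-1)); split.
- by move=> _; apply/epi_vpair; rewrite phiE.
- exact: cvg_cst.
- move=> _; apply/regular_normalP => e e0.
  have n0 : 0 < n%:R + 1 :> R by rewrite ltr_wpDl.
  have c0 : 0 < r / 2 * (n%:R + 1) ^+ 2 by rewrite mulr_gt0 ?exprn_gt0// divr_gt0.
  exists (Num.min (g / (n%:R + 1)) (e / (r / 2 * (n%:R + 1) ^+ 2))).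
    by rewrite lt_min !divr_gt0.
  move=> z; have [x [a ->]] := vpairP z.
  rewrite vpairB le_min => /andP[zg ze] /epi_vpair pxa.
  have [le1 _] := normr_le_vpair (x - xbar) (a - fine (phi xbar)).
  have le_en : enorm (x - xbar) <= (n%:R + 1) * `|x - xbar|.
    by rewrite (le_trans (enorm_le_normr _))// ler_wpM2r// lerDl.
  have xg : enorm (x - xbar) <= g.
    rewrite (le_trans le_en)// mulrC -ler_pdivlMr//; exact: le_trans zg.
  have := le_trans (h x xg) pxa; rewrite phiE -EFinD lee_fin => hx.
  rewrite dotv_vpair mulN1r.
  set d := `|vpair _ _| in ze le1 *.
  apply: (@le_trans _ _ (r / 2 * enorm (x - xbar) ^+ 2)); first by move: hx; lra.
  apply: (@le_trans _ _ (r / 2 * ((n%:R + 1) * d) ^+ 2)).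
    rewrite ler_pM2l ?divr_gt0// ler_pXn2r ?nnegrE ?enorm_ge0 ?mulr_ge0 ?(ltW n0) ?normr_ge0//.
    by rewrite (le_trans le_en)// ler_wpM2l// ltW.
  move: ze; rewrite ler_pdivlMr// => ze.
  rewrite exprMn mulrA [X in _ * X]expr2 mulrA ler_wpM2r ?normr_ge0//.
  by rewrite mulrC.
- exact: cvg_cst.
Qed.

End RegularNormals.

Section LimitingSubgradients.
Context {R : realType} {n m : nat}.
Variables (phi : 'rV[R]_n -> \bar R) (xbar : 'rV[R]_n).
Variables (theta : 'rV[R]_m -> \bar R) (f : 'rV[R]_n -> 'rV[R]_m).
Variables (C r K : R).
Hypothesis (LM : local_model phi xbar theta f C r K).
Local Notation J := (jacobian f xbar).

(** The number [e] collects the error [|h J - (y - f xbar)|] of the pair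
    [(h, y)] and three errors of order [eta]: strict differentiability near
    [xbar], the distance from [f x1] to [f xbar], and the slack of the
    correction property. *)
Lemma regular_normal_estimate rho eta (x1 u h : 'rV[R]_n) (a1 b : R) (y : 'rV[R]_m) :
  0 < rho -> rho <= r -> 0 < eta -> eta <= r / 2 -> C * rho <= eta ->
  `|x1 - xbar| <= rho / 2 -> `|f x1 - f xbar| <= eta ->
  epi phi (vpair x1 a1) ->
  regular_normal_cone (epi phi) (vpair x1 a1) (vpair u (- b)) ->
  edom theta y ->
  forall e, e = `|h *m J - (y - f xbar)| + eta * (`|h| + 2) ->
  dotv u h <= n%:R * `|u| * (K * e)
              + b * (fine (theta y) - fine (theta (f x1)) + K * e).
Proof.
move=> rho0 rhor eta0 etar Crho x1rho fx1 /epi_vpair epi1 /regular_normalP nu Dy e eE.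
have [K0 r0] := (lm_K_gt0 LM, lm_r_gt0 LM).
have e0 : 0 <= e by rewrite eE addr_ge0// mulr_ge0 ?(ltW eta0)// addr_ge0.
have x1rho' : `|x1 - xbar| <= rho.
  by rewrite (le_trans x1rho)// ler_pdivrMr// ler_peMr ?(ltW rho0)// ler1n.
have x1r : `|x1 - xbar| <= r by exact: le_trans rhor.
have Dx1 : edom theta (f x1).
  by rewrite /edom/= -(lm_rep LM x1r) (le_lt_trans epi1)// ltry.
set D := fine (theta y) - _ + _.
apply/ler_addgt0Pr => eps eps0.
pose s := `|h| + K * e + `|D| + 1.
have s0 : 0 < s by rewrite ltr_wpDl// !addr_ge0// mulr_ge0// ltW.
have [d d0 hd] := nu (eps / s) (divr_gt0 eps0 s0).
have [t [t0 t1 [th ty teta td]]] : exists t : R, [/\ 0 < t, t < 1 &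
    [/\ t * `|h| <= rho / 2, t * `|y - f x1| <= r / 2, t * eta <= r & t * s <= d]].
  near (0 : R)^'+ => t; exists t; split.
  - by near: t; exact: nbhs_right_gt.
  - by near: t; exact: nbhs_right_lt.
  - split; near: t; apply: near_right_mul_le => //; exact: divr_gt0.
have t01 : 0 < t < 1 by rewrite t0 t1.
(* [x] is corrected towards [p], which is feasible by convexity. *)
pose x := x1 + t *: h; pose p := f x1 + t *: (y - f x1).
have pE : p = t *: y + (1 - t) *: f x1 by apply/rowP => i; rewrite !mxE; ring.
have [Dp thp] := lm_convex LM Dy Dx1 t01; rewrite -pE in Dp thp.
have xrho : `|x - xbar| <= rho.
  rewrite /x addrAC (le_trans (ler_normD _ _))// normrZ gtr0_norm//.
  by rewrite (splitr rho) lerD.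
have pr : `|p - f xbar| <= r.
  rewrite /p addrAC (le_trans (ler_normD _ _))// normrZ gtr0_norm//.
  by rewrite (splitr r) lerD// (le_trans fx1).
have fxp : `|f x - p| + t * eta <= t * e.
  have := lm_strict LM rhor xrho x1rho'.
  have -> : x - x1 = t *: h by rewrite /x addrAC subrr add0r.
  rewrite normrZ gtr0_norm// -scalemxAl => st.
  have -> : f x - p = (f x - f x1 - t *: (h *m J)) + t *: (h *m J - (y - f xbar))
      + t *: (f x1 - f xbar).
    by rewrite /p; move: (h *m J) => q; apply/rowP => i; rewrite !mxE; ring.
  rewrite eE.
  have -> : t * (`|h *m J - (y - f xbar)| + eta * (`|h| + 2)) =
      eta * (t * `|h|) + t * `|h *m J - (y - f xbar)| + t * eta + t * eta by ring.
  rewrite lerD// (le_trans (ler_normD _ _))// lerD//; last first.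
    by rewrite normrZ gtr0_norm// ler_pM2l.
  rewrite (le_trans (ler_normD _ _))// normrZ gtr0_norm// lerD//.
  by rewrite (le_trans st)// ler_wpM2r// mulr_ge0// ltW.
have teta0 : 0 < t * eta by rewrite mulr_gt0.
have [x' [xx' Dx' phix']] := lm_correction LM (le_trans xrho rhor) pr Dp teta0 teta.
have Ke : K * (`|f x - p| + t * eta) <= t * (K * e).
  by rewrite mulrCA ler_pM2l.
have {}xx' : `|x' - x| <= t * (K * e) by rewrite distrC (le_trans xx').
(* The test point in the epigraph is [(x', a1 + t D)]. *)
have epi' : epi phi (vpair x' (a1 + t * D)).
  apply/epi_vpair/(le_trans phix'); rewrite lee_fin.
  have : fine (theta (f x1)) <= a1.
    by move: epi1; rewrite (lm_rep LM x1r) (lm_fine LM Dx1) lee_fin.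
  by move: Ke thp; rewrite /D; lra.
have x'E : x' - x1 = t *: h + (x' - x).
  by rewrite /x; apply/rowP => i; rewrite !mxE; ring.
have n1 : `|vpair x' (a1 + t * D) - vpair x1 a1| <= t * (s - 1).
  rewrite vpairB (le_trans (normr_vpair_le _ _))// addrAC subrr add0r.
  rewrite normrM gtr0_norm// /s addrK mulrDr lerD// x'E.
  by rewrite (le_trans (ler_normD _ _))// normrZ gtr0_norm// mulrDr lerD.
have ts : t * (s - 1) <= t * s by rewrite ler_pM2l// gerBl.
have := hd _ (le_trans n1 (le_trans ts td)) epi'.
rewrite vpairB dotv_vpair [a1 + _ - _]addrAC subrr add0r mulNr x'E dotvDr dotvZr.
rewrite -{1}x'E.
have : eps / s * `|vpair (x' - x1) (t * D)| <= t * eps.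
  rewrite (_ : t * D = a1 + t * D - a1) -?vpairB; last by rewrite addrAC subrr add0r.
  rewrite mulrAC ler_pdivrMr// [t * eps]mulrC -mulrA ler_pM2l//.
  exact: le_trans ts.
have : - (n%:R * `|u| * (t * (K * e))) <= dotv u (x' - x).
  have := normr_dotv_le u (x' - x); rewrite ler_norml => /andP[+ _].
  by apply: le_trans; rewrite lerN2 ler_wpM2l// mulr_ge0.
move=> B1 B2 B3; rewrite -(ler_pM2l t0).
by move: B1 B2 B3; lra.
Unshelve. all: by end_near. Qed.

(** The penalty term replaces a bounded multiplier: one constant [M] serves
    all [h] and [y], because the constants in [regular_normal_estimate] are
    uniform near [xbar].  The limit is taken by bounding every error by a
    multiple [B] of [eta]. *)
Lemma limiting_subgradient_estimate v : subdifferential phi xbar v ->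
  exists2 M, 0 < M & forall h y, edom theta y ->
    dotv v h - M * `|h *m J - (y - f xbar)| <= fine (theta y) - fine (theta (f xbar)).
Proof.
move=> [zk [vk [epik cz nk cv]]].
have [C0 K0 r0] := And3 (lm_C_gt0 LM) (lm_K_gt0 LM) (lm_r_gt0 LM).
exists (n%:R * `|v| * K + K).
  by rewrite ltr_wpDl// !mulr_ge0// ltW.
move=> h y Dy.
set e := `|_ - _|; set U := `|v|.
pose s := `|h| + 2.
have s0 : 0 <= s by rewrite addr_ge0.
pose D0 := fine (theta y) - fine (theta (f xbar)) + K * e.
pose B : R := n%:R * `|h| + n%:R * K * (U * s + e + s)
  + (`|D0| + K + K * s) + (K + K * s) .
have B0 : 0 <= B.
  by rewrite !addr_ge0 ?mulr_ge0 ?addr_ge0 ?mulr_ge0 ?(ltW K0)// ?normr_ge0.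
suff H (eta : R) : 0 < eta -> eta <= 1 -> eta <= r / 2 ->
    dotv v h <= n%:R * U * (K * e) + D0 + eta * B.
  suff : dotv v h <= n%:R * U * (K * e) + D0.
    by rewrite /D0; lra.
  apply/ler_addgt0Pr => eps eps0.
  pose eta := Num.min (eps / (B + 1)) (Num.min 1 (r / 2)).
  have B1 : 0 < B + 1 by rewrite ltr_wpDl.
  have eta0 : 0 < eta by rewrite !lt_min ltr01 !divr_gt0.
  have [e1 e2 e3] : [/\ eta <= eps / (B + 1), eta <= 1 & eta <= r / 2].
    by rewrite /eta; split; rewrite !ge_min lexx ?orbT.
  rewrite (le_trans (H _ eta0 e2 e3))// lerD2l.
  move: e1; rewrite ler_pdivlMr//; apply: le_trans.
  by rewrite ler_pM2l// lerDl.
move=> eta0 eta1 etar.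
pose rho := Num.min (eta / (C + K)) r.
have CK0 : 0 < C + K by rewrite addr_gt0.
have rho0 : 0 < rho by rewrite lt_min r0 divr_gt0.
have rhor : rho <= r by rewrite ge_min lexx orbT.
have CKrho : (C + K) * rho <= eta.
  by rewrite mulrC -ler_pdivlMr// ge_min lexx.
have Krho : K * rho <= eta.
  by apply: le_trans CKrho; rewrite ler_pM2r// lerDr ltW.
have Crho : C * rho <= eta.
  by apply: le_trans CKrho; rewrite ler_pM2r// lerDl ltW.
have [k [zkr vkr]] : exists k, `|zk k - vpair xbar (fine (phi xbar))| <= rho / 2
    /\ `|vk k - vpair v (-1)| <= eta.
  have rho20 : 0 < rho / 2 by rewrite divr_gt0.
  near \oo => k; exists k; split; near: k.
    exact: cvg_near_ball cz rho20.
  exact: cvg_near_ball cv eta0.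
have [x1 [a1 zE]] := vpairP (zk k); have [u [b' vE]] := vpairP (vk k).
pose b := - b'; have {}vE : vk k = vpair u (- b) by rewrite vE opprK.
move: (epik k) (nk k) zkr vkr; rewrite {}zE {}vE !vpairB => epi1 n1 zkr vkr.
have [+ _] := normr_le_vpair (x1 - xbar) (a1 - fine (phi xbar)).
move=> /le_trans/(_ zkr) x1rho.
have [+ +] := normr_le_vpair (u - v) (- b - -1).
move=> /le_trans/(_ vkr) uv /le_trans/(_ vkr) b1.
have x1r : `|x1 - xbar| <= r.
  by rewrite (le_trans x1rho)// (le_trans _ rhor)// ler_pdivrMr// ler_peMr ?ler1n// ltW.
have fx1 : `|f x1 - f xbar| <= eta.
  rewrite (le_trans (lm_f_lipschitz LM x1r _)) ?subrr ?normr0 ?(ltW r0)//.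
  rewrite (le_trans _ Krho)// ler_pM2l// (le_trans x1rho)//.
  by rewrite ler_pdivrMr// ler_peMr ?ler1n// ltW.
have := regular_normal_estimate (h := h) rho0 rhor eta0 etar Crho x1rho fx1
  epi1 n1 Dy (erefl _).
rewrite -/e -/s.
have Dx1 : edom theta (f x1).
  move: epi1 => /epi_vpair epi1.
  by rewrite /edom/= -(lm_rep LM x1r) (le_lt_trans epi1)// ltry.
have th1 : `|fine (theta (f x1)) - fine (theta (f xbar))| <= K * eta.
  rewrite (le_trans (lm_theta_lipschitz LM Dx1 (lm_base LM) _ _)) ?subrr ?normr0 ?(ltW r0)//.
    by rewrite (le_trans fx1)// (le_trans etar)// ler_pdivrMr// ler_peMr ?ler1n// ltW.
  by rewrite ler_pM2l.
set E := e + eta * s.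
pose D1 := fine (theta y) - fine (theta (f x1)) + K * E; rewrite -/D1 => main.
have e0 : 0 <= e by exact: normr_ge0.
have E0 : 0 <= E by rewrite addr_ge0// mulr_ge0// ltW.
have uU : `|u| <= U + eta.
  by rewrite -[u](subrK v) addrC (le_trans (ler_normD _ _))// lerD2l.
have X : dotv v h <= dotv u h + n%:R * `|h| * eta.
  have := normr_dotv_le (u - v) h; rewrite dotvBl ler_norml => /andP[+ _].
  have : n%:R * `|u - v| * `|h| <= n%:R * `|h| * eta.
    by rewrite mulrAC ler_wpM2l// mulr_ge0.
  lra.
have Y : n%:R * `|u| * (K * E) <= n%:R * U * (K * e) + n%:R * K * (U * s + e + s) * eta.
  rewrite (@le_trans _ _ (n%:R * (U + eta) * (K * E)))//.
    by rewrite ler_wpM2r ?mulr_ge0 ?(ltW K0)// ler_wpM2l.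
  rewrite -subr_ge0 [leRHS](_ : _ = n%:R * K * (eta * s * (1 - eta))); last first.
    by rewrite /E; ring.
  by rewrite !mulr_ge0 ?(ltW K0) ?(ltW eta0)// subr_ge0.
have Z1 : `|D1 - D0| <= eta * (K + K * s).
  have -> : D1 - D0 = - (fine (theta (f x1)) - fine (theta (f xbar))) + K * (eta * s).
    by rewrite /D1 /D0 /E; ring.
  have -> : eta * (K + K * s) = K * eta + K * (eta * s) by ring.
  rewrite (le_trans (ler_normD _ _))// lerD//; first by rewrite normrN.
  by rewrite ger0_norm ?mulr_ge0 ?(ltW K0) ?(ltW eta0).
have D00 : 0 <= K + K * s by rewrite addr_ge0 ?mulr_ge0 ?(ltW K0).
have Z2 : `|D1| <= `|D0| + K + K * s.
  have -> : D1 = D0 + (D1 - D0) by ring.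
  rewrite (le_trans (ler_normD _ _))// -(addrA `|D0|) lerD2l.
  by rewrite (le_trans Z1)// ler_piMl.
have Z : b * D1 <= D0 + eta * (`|D0| + K + K * s) + eta * (K + K * s).
  have -> : b * D1 = D0 + (- (- b - -1)) * D1 + (D1 - D0) by ring.
  rewrite lerD//; last by rewrite (le_trans (ler_norm _)).
  rewrite lerD2l (le_trans (ler_norm _))// normrM normrN.
  by rewrite ler_pM.
have -> : eta * B = n%:R * `|h| * eta + n%:R * K * (U * s + e + s) * eta
    + (eta * (`|D0| + K + K * s) + eta * (K + K * s)) by rewrite /B; ring.
by move: X Y Z main; lra.
Unshelve. all: by end_near. Qed.

Lemma limiting_subgradient_proximal v :
  subdifferential phi xbar v -> prox_subdifferential phi xbar v.
Proof.
move=> /limiting_subgradient_estimate[M M0 est].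
have [C0 r0] := conj (lm_C_gt0 LM) (lm_r_gt0 LM).
exists r, (2 * (M * C)); split=> //; first by rewrite !mulr_gt0.
move=> x xr.
have xr' : `|x - xbar| <= r by rewrite (le_trans (normr_le_enorm _)).
have br : `|xbar - xbar| <= r by rewrite subrr normr0 ltW.
rewrite (lm_rep LM br) (lm_rep LM xr').
have [Dx|] := pselect (edom theta (f x)); last first.
  by rewrite /edom/= => /negP; rewrite -leNgt leye_eq => /eqP ->; rewrite leey.
rewrite (lm_fine LM Dx) (lm_fine LM (lm_base LM)) -EFinD lee_fin.
have := est (x - xbar) _ Dx.
have : M * `|(x - xbar) *m J - (f x - f xbar)| <= M * (C * enorm (x - xbar) ^+ 2).
  rewrite ler_pM2l// distrC.
  have x0 : `|xbar - xbar| <= `|x - xbar| by rewrite subrr normr0.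
  rewrite (le_trans (lm_strict LM xr' (lexx _) x0))// -mulrA ler_pM2l// expr2.
  by rewrite ler_pM// normr_le_enorm.
lra.
Qed.

End LimitingSubgradients.

(** * Second-order tangents *)

Section SecondTangents.
Context {R : realType} {n : nat}.

(** Compactness of closed balls, in the form of a cluster point as [t] tends
    to 0 from the right. *)
Lemma bounded_cluster (U : R -> 'rV[R]_n) (B : R) : 0 < B ->
  (\forall t \near 0^'+, `|U t| <= B) ->
  exists u, forall e, 0 < e -> exists t, [/\ 0 < t, t <= e & `|U t - u| <= e].
Proof.
move=> B0 UB.
have cB : compact (closed_ball (0 : 'rV[R]_n) B).
  apply: bounded_closed_compact; last exact: closed_ball_closed.
  exists B; split; first exact: num_real.
  move=> x Bx u; rewrite closed_ballE// /closed_ball_/= sub0r normrN => /le_trans; apply.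
  exact: ltW.
have [|u [_ clu]] := cB (U @ 0^'+) _.
  apply: filterS UB => t Ut.
  by rewrite closed_ballE// /closed_ball_/= sub0r normrN.
exists u => e e0.
have A1 : (U @ 0^'+) (U @` [set t | 0 < t <= e]).
  by apply/near_rightP; exists e => // t t0 te; exists t => //=; rewrite t0.
have A2 : \forall v \near u, `|v - u| <= e by apply/near_ballP; exists e.
have [_ [[t /= /andP[t0 te] <-] Ute]] := clu _ _ A1 A2.
by exists t.
Qed.

End SecondTangents.

(** In this section [c] is a slope along [w] that is attained, up to
    [O(t^2)], by points [O(t^2)]-close to [xbar + t w]. *)
Section Recovery.
Context {R : realType} {n : nat}.
Variables (phi : 'rV[R]_n -> \bar R) (xbar w : 'rV[R]_n) (c M : R).
Hypothesis rec : \forall t \near 0^'+, exists2 x, `|x - (xbar + t *: w)| <= M * t ^+ 2 &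
  (phi x <= (fine (phi xbar) + t * c + M * t ^+ 2)%:E)%E.

Lemma recovery_subderivative_le : phi xbar = (fine (phi xbar))%:E ->
  (subderivative phi xbar w <= c%:E)%E.
Proof.
move=> phiE; apply/lee_addgt0Pr => e e0; apply: limf_einf_le => V /near_right_prodP[r r0 hV].
have [t [t0 tr [Mtr Mte] [x xw phix]]] : exists t : R, [/\ 0 < t, t <= r,
    t * M <= r /\ t * M <= e & exists2 x, `|x - (xbar + t *: w)| <= M * t ^+ 2 &
  (phi x <= (fine (phi xbar) + t * c + M * t ^+ 2)%:E)%E].
  near (0 : R)^'+ => t; exists t; split.
  - by near: t; exact: nbhs_right_gt.
  - by near: t; exact: nbhs_right_le.
  - by split; near: t; exact: near_right_mul_le.
  - by near: t.
have tn0 : t != 0 by rewrite gt_eqF.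
exists (t, t^-1 *: (x - xbar)) => /=.
  apply: hV => //.
  have -> : t^-1 *: (x - xbar) - w = t^-1 *: (x - (xbar + t *: w)).
    by rewrite opprD addrA [RHS]scalerBr scalerA mulVf// scale1r.
  rewrite normrZ gtr0_norm ?invr_gt0// ler_pdivrMl// (le_trans xw)//.
  by rewrite mulrC expr2 -mulrA ler_pM2l.
have -> : xbar + t *: (t^-1 *: (x - xbar)) = x.
  by rewrite scalerA mulfV// scale1r addrC subrK.
rewrite -EFinD lee_pdivrMr// phiE leeBlDr// -EFinM -EFinD (le_trans phix)// lee_fin.
have : M * t ^+ 2 <= e * t by rewrite expr2 mulrA ler_pM2r// mulrC.
lra.
Unshelve. all: by end_near. Qed.

(** The second-order displacements [U t] are bounded by [2 M], so they cluster
    at some [u]; the scalar component can be taken constant, equal to [2 M],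
    since the epigraph is closed upwards. *)
Lemma recovery_second_tangent : 0 < M ->
  second_tangent_set (epi phi) (vpair xbar (fine (phi xbar))) (vpair w c) !=set0.
Proof.
move=> M0; have /near_rightP[e e0 recE] := rec.
pose x t := if pselect (0 < t <= e) is left te
  then let: conj t0 te' := andP te in s2val (cid2 (recE t t0 te')) else 0.
have xP t : 0 < t -> t <= e -> `|x t - (xbar + t *: w)| <= M * t ^+ 2 /\
    (phi (x t) <= (fine (phi xbar) + t * c + M * t ^+ 2)%:E)%E.
  move=> t0 te; rewrite /x; case: pselect => [te2|]; last by rewrite t0 te.
  by case: (andP te2) => ? ?; case: cid2.
pose U t := (2 / t ^+ 2) *: (x t - (xbar + t *: w)).
have UE t : 0 < t -> xbar + t *: w + (2^-1 * t ^+ 2) *: U t = x t.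
  move=> t0; rewrite /U scalerA.
  have -> : 2^-1 * t ^+ 2 * (2 / t ^+ 2) = 1 by field; rewrite gt_eqF.
  by rewrite scale1r addrC subrK.
have [u hu] : exists u, forall e, 0 < e -> exists t, [/\ 0 < t, t <= e & `|U t - u| <= e].
  apply: (@bounded_cluster _ _ _ (2 * M)); first by rewrite mulr_gt0.
  apply/near_rightP; exists e => // t t0 te.
  have [xt _] := xP t t0 te.
  rewrite /U normrZ ger0_norm; last by rewrite divr_ge0 ?sqr_ge0.
  rewrite mulrAC ler_pdivrMr ?exprn_gt0// -mulrA ler_pM2l//.
have ek k : 0 < Num.min e k.+1%:R^-1 by rewrite lt_min e0/= invr_gt0.
have /choice[t tP] : forall k : nat, exists t, [/\ 0 < t, t <= Num.min e k.+1%:R^-1 &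
    `|U t - u| <= Num.min e k.+1%:R^-1].
  by move=> k; exact: hu.
exists (vpair u (2 * M)), t, (fun k => vpair (U (t k)) (2 * M)); split.
- by move=> k; have [] := tP k.
- apply/cvgrPdist_le => d d0; near=> k.
  have [t0 tk _] := tP k; rewrite sub0r normrN gtr0_norm// (le_trans tk)//.
  rewrite ge_min; apply/orP; right.
  by near: k; exact: near_natSinv_le.
- apply: cvg_of_le_natSinv => k; rewrite vpairB subrr.
  rewrite (le_trans (normr_vpair_le _ _))// normr0 addr0.
  by have [_ _ Uk] := tP k; rewrite (le_trans Uk)// ge_min lexx orbT.
- move=> k; have [t0 tk _] := tP k.
  rewrite !vpairZ !vpairD UE//; apply/epi_vpair.
  have -> : 2^-1 * t k ^+ 2 * (2 * M) = M * t k ^+ 2 by field.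
  by apply: (xP _ t0 _).2; rewrite (le_trans tk)// ge_min lexx.
Unshelve. all: by end_near. Qed.

End Recovery.

Section Tangents.
Context {R : realType} {n m : nat}.
Variables (phi : 'rV[R]_n -> \bar R) (xbar : 'rV[R]_n).
Variables (theta : 'rV[R]_m -> \bar R) (f : 'rV[R]_n -> 'rV[R]_m).
Variables (C r K : R).
Hypothesis (LM : local_model phi xbar theta f C r K).
Hypothesis (pw : pwlq theta).
Local Notation J := (jacobian f xbar).

(** Tangency to the feasible set, phrased with the filter that defines
    subderivatives instead of sequences: both tangent directions and
    directions of finite subderivative have this property. *)
Definition frequently_feasible (w : 'rV[R]_n) := forall V : set (R * 'rV[R]_n),
  filter_prod 0^'+ (nbhs w) V ->
  exists2 p, V p & edom theta (f (xbar + p.1 *: p.2)).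

Lemma tangent_frequently w :
  tangent_cone [set x | edom theta (f x)] xbar w -> frequently_feasible w.
Proof.
move=> [t [wk [t0 ct cw Dk]]] V /near_right_prodP[e e0 hV].
have ht : \forall k \near \oo, `|t k| <= e.
  by move/cvgrPdist_le : ct => /(_ _ e0); apply: filterS => k; rewrite sub0r normrN.
have [k [tk wkk]] : exists k, `|t k| <= e /\ `|wk k - w| <= e.
  near \oo => k; exists k; split; near: k => //.
  exact: cvg_near_ball cw e0.
exists (t k, wk k); last exact: Dk.
by apply: hV => //; rewrite (le_trans (ler_norm _)).
Unshelve. all: by end_near. Qed.

Lemma ray_estimate (w : 'rV[R]_n) t : `|t *: w| <= r ->
  `|f (xbar + t *: w) - (f xbar + t *: (w *m J))| <= C * `|w| ^+ 2 * t ^+ 2.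
Proof.
move=> tw.
have E : xbar + t *: w - xbar = t *: w by rewrite addrAC subrr add0r.
have := @lm_strict _ _ _ _ _ _ _ _ _ _ LM `|t *: w| (xbar + t *: w) xbar tw.
rewrite E subrr normr0 -scalemxAl opprD addrA => /(_ (lexx _) (normr_ge0 _)).
move=> /le_trans; apply.
rewrite normrZ -[t ^+ 2]real_normK ?num_real//.
by rewrite le_eqVlt; apply/orP; left; apply/eqP; ring.
Qed.

Lemma near_ray_estimate (w : 'rV[R]_n) (e : R) : 0 < e ->
  filter_prod 0^'+ (nbhs w) [set p : R * 'rV[R]_n |
    `|p.1 *: p.2| <= r /\
    `|f (xbar + p.1 *: p.2) - (f xbar + p.1 *: (w *m J))| <= p.1 * e].
Proof.
move=> e0; have [C0 r0] := conj (lm_C_gt0 LM) (lm_r_gt0 LM).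
apply/near_right_prodP.
pose a := n%:R * `|J| + 1.
have a0 : 0 < a by rewrite ltr_wpDl// mulr_ge0.
pose W := `|w| + 1.
have W0 : 0 < W by rewrite ltr_wpDl.
pose b := C * W ^+ 2.
have b0 : 0 < b by rewrite mulr_gt0// exprn_gt0.
exists (Num.min (Num.min 1 (e / 2 / a)) (Num.min (r / W) (e / 2 / b))).
  by rewrite !lt_min ltr01 !divr_gt0.
move=> t u t0; rewrite !le_min => /andP[_ /andP[tr tb]] /andP[/andP[u1 ua] _] /=.
have uW : `|u| <= W.
  by rewrite -[u](subrK w) addrC (le_trans (ler_normD _ _))// lerD2l.
have tur : `|t *: u| <= r.
  rewrite normrZ gtr0_norm//; move: tr; rewrite ler_pdivlMr//; apply: le_trans.
  by rewrite ler_pM2l.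
split=> //.
have -> : f (xbar + t *: u) - (f xbar + t *: (w *m J)) =
    (f (xbar + t *: u) - (f xbar + t *: (u *m J))) + t *: ((u - w) *m J).
  rewrite mulmxBl; move: (f _) (f xbar) (u *m J) (w *m J) => v1 v2 v3 v4.
  by apply/rowP => i; rewrite !mxE; ring.
rewrite (splitr e) mulrDr (le_trans (ler_normD _ _))// lerD//.
  rewrite (le_trans (ray_estimate tur))// expr2 mulrA [leRHS]mulrC ler_pM2r//.
  move: tb; rewrite ler_pdivlMr// mulrC; apply: le_trans.
  rewrite ler_pM2r// /b ler_pM2l//.
  by rewrite [leRHS]expr2 ler_pM.
rewrite normrZ gtr0_norm// ler_pM2l// (le_trans (normr_mulmx_le _ _))//.
move: ua; rewrite ler_pdivlMr// => ua; apply: le_trans ua.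
by rewrite mulrAC mulrC ler_wpM2l// lerDl.
Qed.

(** The quotients [(f (xbar + t u) - f xbar) / t] at the feasible points are
    close to [w J], so that [w J] cannot be a direction all of whose
    neighbours leave the domain of [theta]. *)
Lemma tangent_ray (w : 'rV[R]_n) : frequently_feasible w ->
  exists c q : R, exists2 e : R, 0 < e & forall t, 0 <= t <= e ->
    theta (f xbar + t *: (w *m J)) =
      (fine (theta (f xbar)) + t * c + t ^+ 2 * q)%:E.
Proof.
move=> fw; have [//|/near_right_prodP[e e0 he]] := pwlq_ray pw (f xbar) (w *m J).
exfalso; have : filter_prod 0^'+ (nbhs w) [set p : R * 'rV[R]_n | 0 < p.1 <= e].
  by apply/near_right_prodP; exists e => // t u t0 te _ /=; rewrite t0.
move=> /(filterI (near_ray_estimate w e0))/fw[[t u]] /= [[_ est] /andP[t0 te]].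
set y := f (xbar + t *: u) in est * => Dy.
apply: (he t (t^-1 *: (y - f xbar))) => //=; last first.
  by rewrite scalerA mulfV ?gt_eqF// scale1r addrC subrK.
have -> : t^-1 *: (y - f xbar) - w *m J = t^-1 *: (y - (f xbar + t *: (w *m J))).
  by rewrite opprD addrA [RHS]scalerBr scalerA mulVf ?gt_eqF// scale1r.
by rewrite normrZ gtr0_norm ?invr_gt0// ler_pdivrMl.
Qed.

Section AlongRay.
Variables (w : 'rV[R]_n) (c q e : R).
Hypothesis (e0 : 0 < e).
Hypothesis (ray : forall t, 0 <= t <= e ->
  theta (f xbar + t *: (w *m J)) =
    (fine (theta (f xbar)) + t * c + t ^+ 2 * q)%:E).

Lemma phi_base : phi xbar = (fine (theta (f xbar)))%:E.
Proof.
rewrite (lm_rep LM) ?subrr ?normr0 ?(ltW (lm_r_gt0 LM))//.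
exact: (lm_fine LM (lm_base LM)).
Qed.

(** At a feasible point [xbar + t u], with [u] close to [w], the value of
    [phi] differs from the value of [theta] on the ray by [o(t)], by the
    Lipschitz property of [theta] on its domain. *)
Lemma le_subderivative : (c%:E <= subderivative phi xbar w)%E.
Proof.
have [r0 K0] := conj (lm_r_gt0 LM) (lm_K_gt0 LM).
apply/lee_addgt0Pr => eps eps0; rewrite -leeBlDr// -EFinB.
have d0 : 0 < eps / (K + 1) by rewrite divr_gt0// addr_gt0.
set d := eps / (K + 1) in d0.
have dE : K * d + d = eps.
  by rewrite /d; field; rewrite gt_eqF// addr_gt0.
apply: le_limf_einf.
apply: filterS (filterI (near_ray_estimate w d0) _); last first.
  have := near_right_mul_le (`|q|) d0; have := near_right_mul_le d (divr_gt0 r0 (ltr0n R 2)).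
  have := near_right_mul_le (`|w *m J|) (divr_gt0 r0 (ltr0n R 2)).
  move=> /near_rightP[e1 e10 h1] /near_rightP[e2 e20 h2] /near_rightP[e3 e30 h3].
  have : filter_prod 0^'+ (nbhs w) [set p : R * 'rV[R]_n | [/\ 0 < p.1, p.1 <= e,
      p.1 * `|w *m J| <= r / 2, p.1 * d <= r / 2 & p.1 * `|q| <= d]].
    apply/near_right_prodP.
    exists (Num.min (Num.min e e1) (Num.min e2 e3)); first by rewrite !lt_min e0 e10 e20.
    move=> t u t0; rewrite !le_min => /andP[/andP[te t1] /andP[t2 t3]] _ /=.
    by split=> //; [exact: h1|exact: h2|exact: h3].
  exact: id.
move=> [t u] /= [[tur est] [t0 te tw td tq]].
rewrite lee_pdivlMr// phi_base leeBrDr// -EFinM -EFinD.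
have xr : `|xbar + t *: u - xbar| <= r by rewrite addrAC subrr add0r.
rewrite (lm_rep LM xr).
have [Dx|] := pselect (edom theta (f (xbar + t *: u))); last first.
  by rewrite /edom/= => /negP; rewrite -leNgt leye_eq => /eqP ->; rewrite leey.
rewrite (lm_fine LM Dx) lee_fin.
have te' : 0 <= t <= e by rewrite te ltW.
have yE := ray te'.
have Dy : edom theta (f xbar + t *: (w *m J)) by rewrite /edom/= yE ltry.
have ybr : `|t *: (w *m J)| <= r / 2 by rewrite normrZ gtr0_norm.
have yr : `|f xbar + t *: (w *m J) - f xbar| <= r.
  rewrite addrAC subrr add0r (le_trans ybr)//.
  by rewrite ler_pdivrMr// ler_peMr ?ler1n// ltW.
have fxr : `|f (xbar + t *: u) - f xbar| <= r.
  have -> : f (xbar + t *: u) - f xbar =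
      (f (xbar + t *: u) - (f xbar + t *: (w *m J))) + t *: (w *m J).
    by rewrite opprD addrA subrK.
  by rewrite (le_trans (ler_normD _ _))// (splitr r) lerD// (le_trans est).
have := lm_theta_lipschitz LM Dx Dy fxr yr; rewrite yE /= => h.
have {}h := le_trans h (ler_wpM2l (ltW K0) est).
move: h; rewrite ler_norml => /andP[h _].
have : - (t * d) <= t ^+ 2 * q.
  rewrite expr2 -mulrA -mulrN ler_pM2l// lerNl -mulrN.
  by rewrite (le_trans _ tq)// ler_pM2l// ler_normr lexx orbT.
move: h; rewrite -dE; lra.
Qed.

(** The correction property at [xbar + t w], towards the ray, with slack
    [t ^+ 2]. *)
Lemma recovery : exists2 M, 0 < M &
  \forall t \near 0^'+, exists2 x, `|x - (xbar + t *: w)| <= M * t ^+ 2 &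
    (phi x <= (fine (phi xbar) + t * c + M * t ^+ 2)%:E)%E.
Proof.
have [C0 r0 K0] := And3 (lm_C_gt0 LM) (lm_r_gt0 LM) (lm_K_gt0 LM).
pose A := K * (C * `|w| ^+ 2 + 1).
have A0 : 0 < A by rewrite mulr_gt0// ltr_wpDl// mulr_ge0 ?sqr_ge0// ltW.
exists (`|q| + A); first by rewrite ltr_wpDl.
near=> t.
have t0 : 0 < t by near: t; exact: nbhs_right_gt.
have te : t <= e by near: t; exact: nbhs_right_le.
have t1 : t <= 1 by near: t; exact: nbhs_right_le.
have tr : t <= r by near: t; exact: nbhs_right_le.
have tw : t * `|w| <= r by near: t; exact: near_right_mul_le.
have twJ : t * `|w *m J| <= r by near: t; exact: near_right_mul_le.
have te' : 0 <= t <= e by rewrite te ltW.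
have yE := ray te'.
have Dy : edom theta (f xbar + t *: (w *m J)) by rewrite /edom/= yE ltry.
have twr : `|t *: w| <= r by rewrite normrZ gtr0_norm.
have xr : `|xbar + t *: w - xbar| <= r by rewrite addrAC subrr add0r.
have yr : `|f xbar + t *: (w *m J) - f xbar| <= r.
  by rewrite addrAC subrr add0r normrZ gtr0_norm.
have t20 : 0 < t ^+ 2 by rewrite exprn_gt0.
have t2r : t ^+ 2 <= r by rewrite expr2 (le_trans _ tr)// ler_piMl// ltW.
have [x [xx' _ phix]] := lm_correction LM xr yr Dy t20 t2r.
have KA : K * (`|f (xbar + t *: w) - (f xbar + t *: (w *m J))| + t ^+ 2) <= A * t ^+ 2.
  rewrite /A -mulrA ler_pM2l// mulrDl mul1r lerD2r.
  exact: ray_estimate.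
exists x.
  rewrite distrC (le_trans xx')// (le_trans KA)// ler_pM2r// lerDr.
  exact: normr_ge0.
rewrite (le_trans phix)// phi_base yE lee_fin /=.
have : t ^+ 2 * q <= `|q| * t ^+ 2 by rewrite mulrC ler_pM2r// ler_norm.
move: KA; lra.
Unshelve. all: by end_near. Qed.

End AlongRay.

Lemma feasible_direction (w : 'rV[R]_n) : frequently_feasible w ->
  exists2 a : R, subderivative phi xbar w = a%:E &
    second_tangent_set (epi phi) (vpair xbar (fine (phi xbar))) (vpair w a) !=set0.
Proof.
move=> /tangent_ray[c [q [e e0 ray]]].
have [M M0 rec] := recovery e0 ray.
have phiE : phi xbar = (fine (phi xbar))%:E by rewrite phi_base.
exists c; last exact: recovery_second_tangent rec M0.
apply/eqP; rewrite eq_le (recovery_subderivative_le rec phiE).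
exact: le_subderivative e0 ray.
Qed.

End Tangents.

(** * Critical cones *)

Section CriticalCone.
Context {R : realType} {n : nat}.
Variables (phi : 'rV[R]_n -> \bar R) (xbar v : 'rV[R]_n).
Hypothesis phiE : phi xbar = (fine (phi xbar))%:E.

(** If [(u, b)] approximates a second-order tangent at the scale [t], then the
    second-order quotient at [(t, w + t u / 2)] is at most [b - <v, u>]. *)
Lemma second_tangent_second_subderivative w :
  second_tangent_set (epi phi) (vpair xbar (fine (phi xbar)))
    (vpair w (dotv v w)) !=set0 ->
  (second_subderivative phi xbar v w < +oo)%E.
Proof.
move=> [z [t [zk [t0 ct cz ek]]]].
pose N := `|z| + 1; have N0 : 0 < N by rewrite ltr_wpDl.
apply: (@le_lt_trans _ _ (N + n%:R * `|v| * N)%:E); last exact: ltry.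
apply: limf_einf_le => V /near_right_prodP[r r0 hV].
pose d := Num.min r (r / N); have d0 : 0 < d by rewrite lt_min r0/= divr_gt0.
have ht : \forall k \near \oo, `|t k| <= d.
  by move/cvgrPdist_le : ct => /(_ _ d0); apply: filterS => k; rewrite sub0r normrN.
have [k [tk zkz]] : exists k, `|t k| <= d /\ `|zk k - z| <= 1.
  near \oo => k; exists k; split; near: k => //.
  exact: cvg_near_ball cz ltr01.
move: (t0 k) tk (ek k); move: (t k) => {t0 ct ek ht} {}t t0.
rewrite gtr0_norm// le_min => /andP[tr tN].
have zN : `|zk k| <= N.
  by rewrite -[zk k](subrK z) addrC (le_trans (ler_normD _ _))// lerD2l.
have [u [b zE]] := vpairP (zk k).
move: zN; rewrite {}zE => zN.
have [+ +] := normr_le_vpair u b.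
move=> /le_trans/(_ zN) uN /le_trans/(_ zN) bN.
rewrite !vpairZ !vpairD => /epi_vpair.
have -> : xbar + t *: w + (2^-1 * t ^+ 2) *: u = xbar + t *: (w + (2^-1 * t) *: u).
  by apply/rowP => i; rewrite !mxE; ring.
move=> le_phi; exists (t, w + (2^-1 * t) *: u).
  apply: hV => //; rewrite addrAC subrr add0r normrZ ger0_norm ?mulr_ge0 ?(ltW t0)//.
  rewrite -mulrA ler_pdivrMl//.
  have : t * `|u| <= r.
    by move: tN; rewrite ler_pdivlMr//; apply: le_trans; rewrite ler_pM2l.
  lra.
have t20 : 0 < 2^-1 * t ^+ 2 by rewrite mulr_gt0// exprn_gt0.
cbn [fst snd]; rewrite lee_pdivrMr// leeBlDr// phiE leeBlDr// -EFinM -!EFinD.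
rewrite (le_trans le_phi)// lee_fin dotvDr dotvZr.
have := normr_dotv_le v u; rewrite ler_norml => /andP[vu _].
have vN : n%:R * `|v| * `|u| <= n%:R * `|v| * N by rewrite ler_wpM2l// mulr_ge0.
have bN' : b <= N by rewrite (le_trans (ler_norm b)).
have : 2^-1 * t ^+ 2 * (b - dotv v u) <= 2^-1 * t ^+ 2 * (N + n%:R * `|v| * N).
  by rewrite ler_pM2l//; lra.
lra.
Unshelve. all: by end_near. Qed.

Lemma near_dotv (w : 'rV[R]_n) (e : R) : 0 < e ->
  filter_prod 0^'+ (nbhs w) [set p : R * 'rV[R]_n | `|dotv v p.2 - dotv v w| <= e].
Proof.
move=> e0; have n0 : 0 < n%:R * `|v| + 1 by rewrite ltr_wpDl// mulr_ge0.
apply/near_right_prodP; exists (e / (n%:R * `|v| + 1)); first by rewrite divr_gt0.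
move=> t u _ _; rewrite ler_pdivlMr//= => uw.
rewrite -dotvBr (le_trans (normr_dotv_le _ _))//; apply: le_trans uw.
by rewrite mulrC ler_wpM2l// lerDl.
Qed.

Lemma near_right_prod_mul_le (A : R) (w : 'rV[R]_n) (B : R) : 0 < B ->
  filter_prod 0^'+ (nbhs w) [set p : R * 'rV[R]_n | 0 < p.1 /\ p.1 * A <= B].
Proof.
move=> /(near_right_mul_le A)/near_rightP[r r0 h].
by apply/near_right_prodP; exists r => // t u t0 tr _; split=> //; exact: h.
Qed.

(** A second-order quotient bounded by [B] makes the first-order quotient at
    most [<v, u> + t B / 2]. *)
Lemma second_subderivative_subderivative_le w :
  (second_subderivative phi xbar v w < +oo)%E ->
  (subderivative phi xbar w <= (dotv v w)%:E)%E.
Proof.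
move=> fin.
have [B B0 lB] : exists2 B : R, 0 < B & (second_subderivative phi xbar v w < B%:E)%E.
  move: fin; case: second_subderivative => [x _|//|_]; last by exists 1; rewrite // ltNyr.
  by exists (`|x| + 1); [rewrite ltr_wpDl|rewrite lte_fin ltr_pwDr// ler_norm].
apply/lee_addgt0Pr => e e0; apply: limf_einf_le => V FV.
have e20 : 0 < e / 2 by rewrite divr_gt0.
have [[t u] [Vp [du [t0 tB]]] /ltW] := limf_einf_lt lB
  (filterI FV (filterI (near_dotv w e20) (near_right_prod_mul_le (2^-1 * B) w e20))).
cbn [fst snd] in du, t0, tB |- *.
have t20 : 0 < 2^-1 * t ^+ 2 by rewrite mulr_gt0// exprn_gt0.
rewrite lee_pdivrMr// leeBlDr// phiE leeBlDr// -EFinM -!EFinD => le_phi.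
exists (t, u) => //; cbn [fst snd].
rewrite lee_pdivrMr// phiE leeBlDr// -EFinM -EFinD (le_trans le_phi)// lee_fin.
have : t * (t * (2^-1 * B)) <= t * (e / 2) by rewrite ler_pM2l.
have : t * (dotv v u - dotv v w) <= t * (e / 2).
  by rewrite ler_pM2l// (le_trans (ler_norm _)).
lra.
Qed.

Lemma proximal_le_subderivative w : prox_subdifferential phi xbar v ->
  ((dotv v w)%:E <= subderivative phi xbar w)%E.
Proof.
move=> [g [r [g0 r0 prox]]].
apply/lee_addgt0Pr => e e0; rewrite -leeBlDr// -EFinB; apply: le_limf_einf.
have e20 : 0 < e / 2 by rewrite divr_gt0.
pose N := n%:R * (`|w| + 1) + 1.
have N0 : 0 < N by rewrite ltr_wpDl// mulr_ge0// addr_ge0.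
have unit_ball : filter_prod (0 : R)^'+ (nbhs w) [set p | `|p.2 - w| <= 1].
  by apply/near_right_prodP; exists 1.
apply: filterS (filterI (filterI unit_ball (near_dotv w e20))
  (filterI (near_right_prod_mul_le N w g0) (near_right_prod_mul_le (r / 2 * N ^+ 2) w e20))).
move=> [t u] /= [[uw du] [[t0 tg] [_ tr]]].
have utN : enorm (t *: u) <= t * N.
  rewrite (le_trans (enorm_le_normr _))// normrZ gtr0_norm// mulrCA ler_pM2l//.
  rewrite /N ler_wpDr// ler_wpM2l//.
  by rewrite -[u](subrK w) addrC (le_trans (ler_normD _ _))// lerD2l.
have E : xbar + t *: u - xbar = t *: u by rewrite addrAC subrr add0r.
have := prox (xbar + t *: u); rewrite E => /(_ (le_trans utN tg)).
rewrite dotvZr phiE -EFinD => h.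
rewrite lee_pdivlMr// leeBrDr// -EFinM -EFinD (le_trans _ h)// lee_fin.
have : r / 2 * enorm (t *: u) ^+ 2 <= t * (t * (r / 2 * N ^+ 2)).
  have -> : t * (t * (r / 2 * N ^+ 2)) = r / 2 * (t * N) ^+ 2 by ring.
  rewrite ler_pM2l ?divr_gt0// !expr2.
  by rewrite ler_pM// enorm_ge0.
have : t * (t * (r / 2 * N ^+ 2)) <= t * (e / 2) by rewrite ler_pM2l.
have : t * (- (e / 2)) <= t * (dotv v u - dotv v w).
  by rewrite ler_pM2l//; move: du; rewrite ler_norml => /andP[].
lra.
Qed.

End CriticalCone.

(** As [phi xbar] is finite, a finite quotient at [(t, u)] makes [phi] finite
    at [xbar + t u], where [phi = theta o f] once [t u] is small. *)
Lemma finite_subderivative_feasible {R : realType} {n m : nat}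
    (phi : 'rV[R]_n -> \bar R) (xbar w : 'rV[R]_n)
    (theta : 'rV[R]_m -> \bar R) (f : 'rV[R]_n -> 'rV[R]_m) (C r K : R) :
  local_model phi xbar theta f C r K ->
  (subderivative phi xbar w < +oo)%E -> frequently_feasible xbar theta f w.
Proof.
move=> LM fin V FV.
have [[t u] [/= Vp [[tur _] [t0 _]]]] :=
  limf_einf_lt fin (filterI FV (filterI (near_ray_estimate LM w ltr01)
    (near_right_prod_mul_le 0 w ltr01))).
move=> h; exists (t, u) => //=.
have xr : `|xbar + t *: u - xbar| <= r by rewrite addrAC subrr add0r.
rewrite /edom/= -(lm_rep LM xr) ltey; apply/negP => /eqP E.
move: h; rewrite E (phi_base LM) addye// gt0_mulye ?ltxx// lte_fin invr_gt0//.
Qed.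

Theorem theorem4p4 (R : realType) (n m : nat)
    (phi : 'rV[R]_n -> \bar R) (xbar : 'rV[R]_n)
    (theta : 'rV[R]_m -> \bar R) (f : 'rV[R]_n -> 'rV[R]_m)
    (hphi : fully_subamenable_with phi xbar theta f) :
  let Omega := [set x : 'rV[R]_n | edom theta (f x)] in
  let zbar := vpair xbar (fine (phi xbar)) in
  [/\ subdifferential phi xbar = prox_subdifferential phi xbar,
      forall w : 'rV[R]_n, tangent_cone Omega xbar w ->
        exists2 a : R, subderivative phi xbar w = a%:E
          & second_tangent_set (epi phi) zbar (vpair w a) !=set0
    & forall vbar : 'rV[R]_n, subdifferential phi xbar vbar ->
        critical_cone phi xbar vbar
          = edom (second_subderivative phi xbar vbar)].
Proof.
move=> Omega zbar.
have pw : pwlq theta by case: hphi => _ [].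
have [C [r [K LM]]] := local_modelP hphi.
have phiE : phi xbar = (fine (phi xbar))%:E by rewrite (phi_base LM).
have dir w := feasible_direction LM pw (w := w).
split.
- apply/seteqP; split=> v; first exact: (limiting_subgradient_proximal LM).
  exact: proximal_subgradient_limiting.
- by move=> w /tangent_frequently; exact: dir.
move=> v sv; have pv := limiting_subgradient_proximal LM sv.
apply/seteqP; split=> w.
  rewrite /critical_cone/= => vw.
  have fin : (subderivative phi xbar w < +oo)%E by rewrite vw ltry.
  have [a] := dir w (finite_subderivative_feasible LM fin).
  rewrite vw => -[<-] T2.
  exact: (second_tangent_second_subderivative phiE T2).
move=> fin; apply/eqP; rewrite eq_le.
by rewrite (second_subderivative_subderivative_le phiE fin) (proximal_le_subderivative phiE).
Qed.
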